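(* Let $G$ be a finite graph (with a loop at every vertex) that has no universal vertices and no true twins. Then the following are equivalent: (I) $G$ is a circular-arc graph; (II) the circular completion of $G$ contains no anchored invertible pair.
   Context: Graphs are finite, undirected, without parallel edges, and every vertex $u$ carries a loop $uu$. $N(u)$ is the set of vertices $v\neq u$ with $uv\in E$, and $N[u]=N(u)\cup\{u\}$. A vertex $u$ is universal if $N[u]=V$; $u,v$ are true twins if $N[u]=N[v]$. A walk $x_1 - x_2 - \cdots - x_k$ is a sequence of (not necessarily distinct) vertices with $x_ix_{i+1}\in E$; since loops exist, consecutive vertices may coincide. A circular-arc graph is the intersection graph of a family of arcs of a circle (one arc per vertex, adjacency iff the arcs intersect). Edge types: an edge $uv$ is an inclusion edge if $N[u]\subseteq N[v]$ or $N[v]\subseteq N[u]$ (in particular loops are inclusion edges), and an overlap edge otherwise; $x$ overlaps $y$ if $xy$ is an overlap edge. A pair $\{u,v\}$ is a spanning pair if (C1) every $x\in V\setminus N[v]$ satisfies $N[x]\subseteq N[u]$ and (C2) every $y\in V\setminus N[u]$ satisfies $N[y]\subseteq N[v]$. An overlap edge $uv$ is a 2-overlap edge if $\{u,v\}$ is a spanning pair, and a 1-overlap edge otherwise. So every edge is of exactly one type: inclusion, 1-overlap, or 2-overlap. $\{u,v\}$ is a circular pair if it is a spanning pair and $uv\notin E$. A graph is circularly-paired if every vertex belongs to some circular pair. A circular completion of $G$ is a circularly-paired graph $H$ with the smallest possible number of vertices such that $G$ is an induced subgraph of $H$ and every edge of $G$ has the same type (inclusion / 1-overlap / 2-overlap)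 in $G$ as in $H$ (for $G$ without universal vertices or true twins it exists and is unique up to isomorphism). Avoidance: a vertex $z$ and a walk $P$ avoid each other if (i) every neighbour of $z$ on $P$ overlaps $z$, and (ii) whenever $z$ overlaps both endpoints $x,y$ of an edge $xy$ of $P$, the vertices $x,y$ do not overlap each other. $z$ avoids the edge $xy$ if it avoids the walk $x - y$ ($x=y$ allowed). Two walks $P=x_1-\cdots-x_k$ and $Q=y_1-\cdots-y_k$ of the same length avoid each other if for each $1\le i<k$, $x_i$ avoids the edge $y_iy_{i+1}$ and $y_{i+1}$ avoids the edge $x_ix_{i+1}$. For distinct vertices $x,y,z$, the pair $\{x,y\}$ is a $z$-invertible pair (an invertible pair anchored at $z$, or anchored invertible pair) if there exist an $xy$-walk and a $yx$-walk that avoid each other and both avoid $z$. *)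

(* Defs.v *)
From mathcomp Require Import all_boot all_order all_algebra.
From mathcomp Require Import classical_sets reals.

Set Implicit Arguments.
Unset Strict Implicit.
Unset Printing Implicit Defensive.


Record lgraph := LGraph {
  vertex :> finType;
  adj : rel vertex;
  adj_sym : symmetric adj;
  adj_refl : reflexive adj
}.

Definition open_nbh (G : lgraph) (u : G) : {set G} :=
  [set v : G | (v != u) && adj u v]%SET.

Definition closed_nbh (G : lgraph) (u : G) : {set G} := (u |: open_nbh u)%SET.

Definition universal (G : lgraph) (u : G) : bool := closed_nbh u == [set: G]%SET.

Definition true_twins (G : lgraph) (u v : G) : bool :=
  closed_nbh u == closed_nbh v.

(* The circle is R/Z, and a subset of it is represented by its preimage in R:
   [arc a b] is the closed arc swept counterclockwise from the class of [a] to
   the class of [b]. It is meant for [a <= b]; a point ([a = b]) and the whole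
   circle ([a + 1 <= b]) are allowed. *)
Definition arc (R : realType) (a b : R) : set R :=
  [set t : R | exists k : int, (a <= t + k%:~R <= b)%R]%classic.

Definition circular_arc_graph (R : realType) (G : lgraph) : Prop :=
  exists l r : G -> R,
    (forall u, (l u <= r u)%R) /\
    (forall u v, adj u v <-> (arc (l u) (r u) `&` arc (l v) (r v) !=set0)%classic).

Definition inclusion_edge (G : lgraph) (u v : G) : bool :=
  adj u v && ((closed_nbh u \subset closed_nbh v)
              || (closed_nbh v \subset closed_nbh u)).

Definition overlap_edge (G : lgraph) (u v : G) : bool :=
  adj u v && ~~ inclusion_edge u v.

Definition spanning_pair (G : lgraph) (u v : G) : bool :=
  [forall x, (x \notin closed_nbh v) ==> (closed_nbh x \subset closed_nbh u)]
  && [forall y, (y \notin closed_nbh u) ==> (closed_nbh y \subset closed_nbh v)].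

Definition overlap2_edge (G : lgraph) (u v : G) : bool :=
  overlap_edge u v && spanning_pair u v.

Definition overlap1_edge (G : lgraph) (u v : G) : bool :=
  overlap_edge u v && ~~ spanning_pair u v.

Definition circular_pair (G : lgraph) (u v : G) : bool :=
  spanning_pair u v && ~~ adj u v.

Definition circularly_paired (G : lgraph) : Prop :=
  forall u : G, exists v : G, circular_pair u v.

Definition type_preserving_embedding (G H : lgraph) (f : G -> H) : Prop :=
  [/\ injective f,
      forall u v, adj (f u) (f v) = adj u v &
      forall u v, adj u v ->
        [/\ inclusion_edge (f u) (f v) = inclusion_edge u v,
            overlap1_edge (f u) (f v) = overlap1_edge u v &
            overlap2_edge (f u) (f v) = overlap2_edge u v]].

Definition circular_extension (G H : lgraph) : Prop :=
  circularly_paired H /\ exists f : G -> H, type_preserving_embedding f.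

Definition circular_completion (G H : lgraph) : Prop :=
  circular_extension G H /\
  forall H' : lgraph, circular_extension G H' -> #|H| <= #|H'|.

(* In clause (i) of avoidance, "neighbour" is taken with respect to [adj], so
   it includes [z] itself: as a loop is not an overlap edge, a vertex never
   avoids a walk passing through it. *)
Definition avoids (G : lgraph) (z : G) (P : seq G) : bool :=
  all (fun w => adj z w ==> overlap_edge z w) P
  && sorted (fun x y => overlap_edge z x && overlap_edge z y
                        ==> ~~ overlap_edge x y) P.

Definition avoids_edge (G : lgraph) (z x y : G) : bool := avoids z [:: x; y].

Definition walk_between (G : lgraph) (x y : G) (P : seq G) : bool :=
  if P is x1 :: p then [&& x1 == x, path (@adj G) x1 p & last x1 p == y]
  else false.

(* The default value [d] of [nth] is irrelevant, all indices being in range. *)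
Definition walks_avoid (G : lgraph) (P Q : seq G) : Prop :=
  size P = size Q /\
  forall (d : G) (i : nat), i.+1 < size P ->
    avoids_edge (nth d P i) (nth d Q i) (nth d Q i.+1) /\
    avoids_edge (nth d Q i.+1) (nth d P i) (nth d P i.+1).

Definition invertible_pair (G : lgraph) (z x y : G) : Prop :=
  [/\ x != y, x != z & y != z] /\
  exists P Q : seq G,
    [/\ walk_between x y P, walk_between y x Q,
        walks_avoid P Q, avoids z P & avoids z Q].

Definition has_anchored_invertible_pair (G : lgraph) : Prop :=
  exists z x y : G, invertible_pair z x y.

(* Main.v *)
Require Import Defs.
From mathcomp Require Import all_boot all_order all_algebra.
From mathcomp Require Import classical_sets reals.
From mathcomp Require boolp.
From mathcomp Require Import zify lra.

Set Implicit Arguments.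
Unset Strict Implicit.
Unset Printing Implicit Defensive.

(** Let [H] be a completion of [G]. Minimality makes [H] free of twins, so every
vertex [u] has a unique circular partner [copair u]; the partners reverse the
order [N[u] <= N[v]], and [u], [v] are adjacent iff not [u <= copair v]. Hence
[H] is a finite poset with an order-reversing involution, in which the involution
plays the role of complementing an arc.

If [H] has no anchored invertible pair, fix a minimal vertex [z]. The moves of
pairs of walks avoiding each other and [z] generate an equivalence on ordered
pairs of vertices, and a consistent choice of orientations of its classes says
which vertices crossing [z] contain its left end. Complementing the others
leaves a family in which every vertex misses the right end of [z]; on it
"before" is forced in the same way as for intervals of a line, and orienting the
classes by their lexicographically smallest pair makes "before" transitive (a
cyclic triangle could be moved along one of its classes to the smallest pair of
that class). Endpoint ranks then give intervals, and complementing back gives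
arcs.

Conversely, the arcs of [G] can be normalised to half-open arcs for which [<=] is
inclusion, non-adjacency is disjointness and spanning pairs are those covering
the circle. With complements this represents [H]; cutting the circle at [z],
the order of the left ends is constant along pairs of walks avoiding each other
and [z], so no such pair of walks can exchange two vertices. *)

(** * Orienting forcing classes *)

Section LexOrientation.
Variables (T : finType) (e : rel (T * T)).
Hypothesis e_sym : symmetric e.
Hypothesis e_swap : forall x y x' y', e (x, y) (x', y') -> e (y, x) (y', x').
Hypothesis e_consistent : forall x y, x != y -> ~~ connect e (x, y) (y, x).

Let rk (x : T) : nat := enum_rank x.

Let rk_lt x : rk x < #|T|. Proof. exact: ltn_ord. Qed.

Let rk_inj : injective rk.
Proof. by move=> x y /val_inj/enum_rank_inj. Qed.

(** As ranks lie below [#|T|], this is a two-digit number in base [#|T|]: it compares unordered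
    pairs lexicographically, smaller rank first. *)
Definition lex_weight (p : T * T) : nat :=
  minn (rk p.1) (rk p.2) * #|T| + maxn (rk p.1) (rk p.2).

(** A class is chosen when one of its lightest pairs increases in rank. Reversing all pairs
    preserves weights, so a class competes exactly with its reversal. *)
Definition lex_orient (x y : T) : bool :=
  [exists q : T * T, [&& connect e (x, y) q, rk q.1 < rk q.2 &
     [forall q', connect e (x, y) q' ==> (lex_weight q <= lex_weight q')]]].

Lemma connect_e_sym : connect_sym e.
Proof.
by move=> p q; rewrite connect_rev; apply: eq_connect => a b /=; rewrite e_sym.
Qed.

Lemma connect_swap x y x' y' :
  connect e (x, y) (x', y') -> connect e (y, x) (y', x').
Proof.
move=> /connectP[s]; elim: s x y => [|[u v] s IH] x y /=.
  by move=> _ [-> ->].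
move=> /andP[exy /IH{}IH] /IH; apply: connect_trans.
by apply: connect1; apply: e_swap.
Qed.

Lemma lex_weight_swap x y : lex_weight (x, y) = lex_weight (y, x).
Proof. by rewrite /lex_weight /= minnC maxnC. Qed.

Lemma leq_lex_weight p q : lex_weight p <= lex_weight q ->
  minn (rk p.1) (rk p.2) < minn (rk q.1) (rk q.2) \/
  minn (rk p.1) (rk p.2) = minn (rk q.1) (rk q.2) /\
  maxn (rk p.1) (rk p.2) <= maxn (rk q.1) (rk q.2).
Proof.
rewrite /lex_weight.
have := rk_lt p.1; have := rk_lt p.2; have := rk_lt q.1; have := rk_lt q.2.
move: (rk p.1) (rk p.2) (rk q.1) (rk q.2) #|T| => a b c d N.
by case: (ltngtP (minn a b) (minn c d)) => ?; nia.
Qed.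

Lemma lex_orient_eq x y x' y' :
  connect e (x, y) (x', y') -> lex_orient x y = lex_orient x' y'.
Proof.
move=> c; apply: eq_existsb => q; congr [&& _, _ & _].
  by rewrite (same_connect connect_e_sym c).
by apply: eq_forallb => q'; rewrite (same_connect connect_e_sym c).
Qed.

Lemma lex_min_exists x y : exists2 q, connect e (x, y) q &
  forall q', connect e (x, y) q' -> lex_weight q <= lex_weight q'.
Proof.
have c0 := connect0 e (x, y).
by case: (arg_minnP lex_weight c0) => q cq qmin; exists q.
Qed.

Lemma lex_orientN x y : x != y -> lex_orient y x = ~~ lex_orient x y.
Proof.
move=> xy.
have minE a b q : connect e (a, b) q ->
    (forall q', connect e (a, b) q' -> lex_weight q <= lex_weight q') ->
    rk q.1 < rk q.2 -> lex_orient a b.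
  move=> cq qmin lt; apply/existsP; exists q; rewrite cq lt /=.
  by apply/forallP=> q'; apply/implyP/qmin.
(* If both were chosen, the two increasing lightest pairs would have equal weight, hence coincide,
   and would connect the class to its reversal. *)
have both : lex_orient x y -> lex_orient y x -> False.
  move=> /existsP[[a b] /and3P[/= cab ltab /forallP minab]].
  move=> /existsP[[c d] /and3P[/= ccd ltcd /forallP mincd]].
  have := implyP (minab (d, c)) (connect_swap ccd).
  have := implyP (mincd (b, a)) (connect_swap cab).
  move=> /leq_lex_weight /= w1 /leq_lex_weight /= w2.
  have /rk_inj eac : rk a = rk c by lia.
  have /rk_inj ebd : rk b = rk d by lia.
  move: ccd; rewrite -eac -ebd => ccd; case/negP: (e_consistent xy).
  by apply: connect_trans cab _; rewrite connect_e_sym.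
have some : lex_orient x y || lex_orient y x.
  have [[a b] cab minab] := lex_min_exists x y.
  have [lt|lt|/rk_inj eqab] := ltngtP (rk a) (rk b).
  - by rewrite (minE x y (a, b)).
  - rewrite orbC (minE y x (b, a)) //; first exact: connect_swap.
    by move=> [c d] /connect_swap/minab; rewrite lex_weight_swap (lex_weight_swap c).
  (* A diagonal pair is its own reversal, so it cannot lie in a consistent class. *)
  rewrite -eqab in cab; case/negP: (e_consistent xy).
  by apply: (connect_trans cab); rewrite connect_e_sym; apply: connect_swap.
by case: (lex_orient x y) (lex_orient y x) both some => [] [] // H; case: H.
Qed.

Section Triangle.
Variable par : rel T.
Hypothesis par_sym : symmetric par.
Hypothesis par_neq : forall x y, par x y -> x != y.

Local Notation D := lex_orient.

(** Only agreement of the three orientations is asked, so cycles of both directions are covered and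
    reversal is a symmetry. *)
Definition cyclic3 (a b c : T) : bool :=
  [&& par a b, par b c, par c a, D a b == D b c & D b c == D c a].

Hypothesis cyclic3_step : forall a b c c', cyclic3 a b c ->
  e (b, c) (b, c') -> par a c' /\ e (a, c) (a, c').
Hypothesis e_cases : forall x y x' y', e (x, y) (x', y') ->
  par x' y' /\ (x = x' \/ y = y').

Lemma cyclic3_rot a b c : cyclic3 a b c -> cyclic3 b c a.
Proof. by case/and5P=> ? ? ? /eqP E1 /eqP E2; apply/and5P; split=> //; rewrite -?E2 ?E1. Qed.

Lemma cyclic3_flip a b c : cyclic3 a b c -> cyclic3 a c b.
Proof.
case/and5P=> ab bc ca /eqP E1 /eqP E2; apply/and5P; split; rewrite 1?par_sym //.
  by rewrite (lex_orientN (par_neq bc)) (lex_orientN (par_neq ca)) -E2.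
by rewrite (lex_orientN (par_neq bc)) (lex_orientN (par_neq ab)) -E1.
Qed.

Lemma cyclic3_move_step a b c b' c' : cyclic3 a b c -> e (b, c) (b', c') ->
  [/\ cyclic3 a b' c', connect e (a, b) (a, b') & connect e (a, c) (a, c')].
Proof.
have right b0 c0 c1 : cyclic3 a b0 c0 -> e (b0, c0) (b0, c1) ->
    cyclic3 a b0 c1 /\ connect e (a, c0) (a, c1).
  move=> tri st; have [pac1 st'] := cyclic3_step tri st.
  split; last exact: connect1.
  case/and5P: tri => ab bc ca /eqP E1 /eqP E2.
  have [bc1 _] := e_cases st.
  have Eb := lex_orient_eq (connect1 st); have Ea := lex_orient_eq (connect1 st').
  apply/and5P; split; rewrite // 1?par_sym // -?Eb ?E1 //.
  by rewrite (lex_orientN (par_neq pac1)) -Ea E2 (lex_orientN (par_neq ca)) negbK.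
move=> tri st; have [_ [eb|ec]] := e_cases st.
  by subst b'; have [? ?] := right _ _ _ tri st.
subst c'; have [t ?] := right _ _ _ (cyclic3_flip tri) (e_swap st).
by split=> //; apply: cyclic3_flip.
Qed.

(** Iterating the local step lets the edge opposite [a] be replaced by any pair of its class, in
    particular a lightest one, while the other two edges stay in their classes. *)
Lemma cyclic3_move a b c b' c' : cyclic3 a b c -> connect e (b, c) (b', c') ->
  [/\ cyclic3 a b' c', connect e (a, b) (a, b') & connect e (a, c) (a, c')].
Proof.
move=> tri /connectP[s]; elim: s b c tri => [|[u v] s IH] b c tri /=.
  by move=> _ [-> ->].
case/andP=> st /IH{}IH /IH{}IH.
have [t cb cc] := cyclic3_move_step tri st.
have [t' cb' cc'] := IH t; split=> //; [exact: connect_trans cb _|exact: connect_trans cc _].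
Qed.

Lemma lex_orient_acyclic a b c : ~~ cyclic3 a b c.
Proof.
(* [m x y w] says that [w] is the minimum weight over the class of [(x, y)]. *)
pose m x y := fun w => (exists2 q, connect e (x, y) q & w = lex_weight q) /\
  forall q', connect e (x, y) q' -> w <= lex_weight q'.
have m_ex x y : exists w, m x y w.
  by have [q c1 c2] := lex_min_exists x y; exists (lex_weight q); split; [exists q|].
have m_swap x y w : m x y w -> m y x w.
  case=> -[[u v] cq ->] wmin; split.
    by exists (v, u); [exact: connect_swap|rewrite lex_weight_swap].
  by move=> [u' v'] /connect_swap/wmin; rewrite (lex_weight_swap u').
(* The normal form: the edge [b0 c0] is itself lightest in its class and no heavier than the other
   edges or the class of [(b0, a0)]. Then the ranks satisfy [b0 < c0 < a0], and a lightest pair of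
   the class of [(b0, a0)] must contain [b0]. *)
have key a0 b0 c0 : cyclic3 a0 b0 c0 -> rk b0 < rk c0 ->
    (forall q, connect e (b0, c0) q -> lex_weight (b0, c0) <= lex_weight q) ->
    (forall q, connect e (b0, a0) q -> lex_weight (b0, c0) <= lex_weight q) ->
    lex_weight (b0, c0) <= lex_weight (a0, c0) -> False.
  move=> tri lt0 min1 min2 min3.
  case/and5P: (tri) => ab bc ca /eqP E1 /eqP E2.
  have Dbc : D b0 c0.
    apply/existsP; exists (b0, c0); rewrite connect0 lt0 /=.
    by apply/forallP=> q; apply/implyP/min1.
  have /leq_lex_weight /= := min2 _ (connect0 e (b0, a0)).
  have /leq_lex_weight /= := min3.
  have nac : rk a0 <> rk c0 by move/rk_inj=> eac; case/eqP: (par_neq ca).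
  have nab : rk a0 <> rk b0 by move/rk_inj=> eac; case/eqP: (par_neq ab).
  move=> o1 o2; have lta : rk c0 < rk a0 by lia.
  have [[u v] cuv minuv] := lex_min_exists b0 a0.
  have /leq_lex_weight /= w1 := min2 _ cuv.
  have /leq_lex_weight /= w2 := minuv _ (connect0 e (b0, a0)).
  have [/rk_inj eu|/rk_inj ev] : rk u = rk b0 \/ rk v = rk b0 by lia.
    subst u; have : D b0 a0.
      apply/existsP; exists (b0, v); rewrite cuv /=; apply/andP; split; first by lia.
      by apply/forallP=> q; apply/implyP/minuv.
    by rewrite (lex_orientN (par_neq ab)) E1 Dbc.
  (* Here the class of [(b0, a0)] reaches [(u, b0)]. Moving that edge with [c0] fixed puts
     [(c0, a0)] and [(c0, b0)] in one class, against cyclicity. *)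
  subst v.
  have tri' : cyclic3 c0 b0 a0 by apply/cyclic3_flip/cyclic3_rot/cyclic3_rot.
  have [_ _ /lex_orient_eq] := cyclic3_move tri' cuv.
  by rewrite (lex_orientN (par_neq bc)) -E2 Dbc.
(* If the class of [b0 c0] has the least minimum of the three, moving that edge to its lightest
   pair, and flipping if necessary, gives the normal form of [key]. *)
have key2 a0 b0 c0 w1 w2 w3 : cyclic3 a0 b0 c0 -> m b0 c0 w1 -> m a0 b0 w2 -> m c0 a0 w3 ->
    w1 <= w2 -> w1 <= w3 -> False.
  move=> tri; case=> -[[u v] cuv ->] w1min m2 m3 le2 le3.
  have [tri' cau cav] := cyclic3_move tri cuv.
  have w1min' q : connect e (u, v) q -> lex_weight (u, v) <= lex_weight q.
    by move=> cq; apply: w1min; apply: connect_trans cuv cq.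
  have w2min q : connect e (u, a0) q -> lex_weight (u, v) <= lex_weight q.
    move=> cq; apply: leq_trans le2 _; apply: (m_swap _ _ _ m2).2.
    by apply: connect_trans cq; apply: connect_swap.
  have w3min q : connect e (v, a0) q -> lex_weight (u, v) <= lex_weight q.
    move=> cq; apply: leq_trans le3 _; apply: m3.2.
    by apply: connect_trans cq; apply: connect_swap.
  have [lt|lt|/rk_inj euv] := ltngtP (rk u) (rk v).
  - by apply: (key _ _ _ tri') => //; rewrite (lex_weight_swap a0); apply: w3min.
  - apply: (key _ _ _ (cyclic3_flip tri')) => //.
    + by move=> [x y] /connect_swap/w1min'; rewrite lex_weight_swap (lex_weight_swap x).
    + by move=> q /w3min; rewrite lex_weight_swap.
    + by rewrite lex_weight_swap (lex_weight_swap a0); apply: w2min.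
  by case/and5P: tri' => _ /par_neq; rewrite euv eqxx.
apply/negP=> tri.
have [w1 m1] := m_ex b c; have [w2 m2] := m_ex a b; have [w3 m3] := m_ex c a.
have [le12|lt21] := leqP w1 w2; have [le13|lt31] := leqP w1 w3.
- exact: (key2 _ _ _ _ _ _ tri m1 m2 m3).
- by apply: (key2 _ _ _ _ _ _ (cyclic3_rot tri) m3 m1 m2); lia.
- by apply: (key2 _ _ _ _ _ _ (cyclic3_rot (cyclic3_rot tri)) m2 m3 m1); lia.
have [le23|lt32] := leqP w2 w3.
- by apply: (key2 _ _ _ _ _ _ (cyclic3_rot (cyclic3_rot tri)) m2 m3 m1); lia.
by apply: (key2 _ _ _ _ _ _ (cyclic3_rot tri) m3 m1 m2); lia.
Qed.

End Triangle.
End LexOrientation.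

(** * Intervals with prescribed inclusions and disjointness *)

Section IntervalRealizer.
Variables (T : finType) (le dj : rel T).
Hypothesis le_refl : reflexive le.
Hypothesis le_anti : antisymmetric le.
Hypothesis le_trans : transitive le.
Hypothesis dj_sym : symmetric dj.
Hypothesis dj_incomp : forall x y, dj x y -> ~~ le x y.
Hypothesis dj_down : forall x y w, le x y -> dj y w -> dj x w.

Let cmp (x y : T) : bool := le x y || le y x.
Let par (x y : T) : bool := ~~ cmp x y.

Let forced1 (x y y' : T) : bool :=
  [&& par x y, par x y', ~~ dj y y' & [|| cmp y y', dj x y | dj x y']].

Definition forced (p q : T * T) : bool :=
  (p.1 == q.1) && forced1 p.1 p.2 q.2 || (p.2 == q.2) && forced1 p.2 p.1 q.1.

(** An orientation respecting the forcing, not assumed transitive. It certifies that no forcing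
    class contains a pair and its reversal; the transitive order is then built by [lex_orient]. *)
Variable D0 : rel T.
Hypothesis D0N : forall x y, ~~ le x y -> ~~ le y x -> D0 y x = ~~ D0 x y.
Hypothesis D0_forced : forall x y y', ~~ le x y -> ~~ le y x ->
  ~~ le x y' -> ~~ le y' x -> ~~ dj y y' ->
  [|| le y y', le y' y, dj x y | dj x y'] -> D0 x y = D0 x y'.

Lemma cmp_sym : symmetric cmp. Proof. by move=> x y; rewrite /cmp orbC. Qed.

Lemma par_sym : symmetric par. Proof. by move=> x y; rewrite /par cmp_sym. Qed.

Lemma par_neq x y : par x y -> x != y.
Proof. by apply: contraNneq => ->; rewrite /cmp le_refl. Qed.

Lemma dj_par x y : dj x y -> par x y.
Proof.
move=> d; rewrite /par /cmp negb_or (dj_incomp d) /=.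
by rewrite dj_sym in d; rewrite (dj_incomp d).
Qed.

Lemma cmp_ndj x y : cmp x y -> ~~ dj x y.
Proof. by apply: contraL => /dj_par. Qed.

Lemma forced1_sym x y y' : forced1 x y y' = forced1 x y' y.
Proof.
rewrite /forced1 (dj_sym y) (cmp_sym y) (orbC (dj x y)).
by case: (par x y); case: (par x y').
Qed.

Lemma forced_sym : symmetric forced.
Proof.
move=> [x y] [x' y'] /=; rewrite /forced /= (eq_sym x') (eq_sym y').
congr (_ || _); first by case: eqP => //= ->; rewrite forced1_sym.
by case: eqP => //= ->; rewrite forced1_sym.
Qed.

Lemma forced_swap x y x' y' : forced (x, y) (x', y') -> forced (y, x) (y', x').
Proof. by rewrite /forced /= orbC. Qed.

Lemma forced_cases x y x' y' : forced (x, y) (x', y') ->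
  par x' y' /\ (x = x' \/ y = y').
Proof.
rewrite /forced /=; case/orP=> /andP[/eqP<- /and4P[? ? ? ?]].
  by split=> //; left.
by split; [rewrite par_sym|right].
Qed.

Lemma D0_forced1 x y y' : forced1 x y y' -> D0 x y = D0 x y'.
Proof.
case/and4P; rewrite /par /cmp !negb_or => /andP[? ?] /andP[? ?] ?.
by rewrite -orbA; apply: D0_forced.
Qed.

Lemma D0_par x y : par x y -> D0 y x = ~~ D0 x y.
Proof. by rewrite /par negb_or => /andP[]; apply: D0N. Qed.

Lemma D0_connect x y x' y' : connect forced (x, y) (x', y') -> D0 x y = D0 x' y'.
Proof.
move=> /connectP[s]; elim: s x y => [|[u v] s IH] x y /=; first by move=> _ [-> ->].
case/andP=> st /IH{}IH /IH{IH}<-; move: st; rewrite /forced /=.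
case/orP=> /andP[/eqP<- f]; first exact: D0_forced1.
case/and4P: (f) => p1 p2 _ _.
by rewrite (D0_par p1) (D0_par p2) (D0_forced1 f).
Qed.

Lemma forced_consistent x y : x != y -> ~~ connect forced (x, y) (y, x).
Proof.
move=> xy; apply/negP=> c.
have p : par x y.
  case/connectP: (c) => [[|[u v] s]] /=; first by move=> _ [E]; rewrite E eqxx in xy.
  case/andP=> st _ _; rewrite forced_sym in st.
  by case: (forced_cases st).
by have := D0_connect c; rewrite (D0_par p); case: (D0 x y).
Qed.

Local Notation D := (lex_orient forced).

Lemma D_forced x y y' : forced1 x y y' -> D x y = D x y'.
Proof.
move=> f; apply: (lex_orient_eq forced_sym); apply: connect1.
by rewrite /forced /= eqxx f.
Qed.

Lemma D_par x y : par x y -> D y x = ~~ D x y.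
Proof.
move=> p; apply: lex_orientN; [exact: forced_sym|exact: forced_swap|exact: forced_consistent|].
exact: par_neq.
Qed.

(** In a cyclic triangle [b] sees [c] and [a] on different sides, so no forcing at [b] links [c], or
    a [c'] forced together with [c], to [a]. Hence [a] and [c'] are incomparable, and whichever of
    [c], [c'] misses [b] also misses [a], which carries the forcing over to [a]. *)
Lemma cyclic3_forced a b c c' : cyclic3 forced par a b c ->
  forced (b, c) (b, c') -> par a c' /\ forced (a, c) (a, c').
Proof.
case/and5P=> ab bc ca /eqP E1 /eqP E2.
have Eb : D b c <> D b a by rewrite (D_par ab) -E1; case: (D a b).
have {Eb} nba : ~~ forced1 b c a by apply/negP=> /D_forced.
rewrite /forced /= !eqxx /= => st.
have {st} st : forced1 b c c'.
  case/orP: st => // /andP[/eqP <- _]; rewrite /forced1 bc /=.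
  by rewrite cmp_ndj /cmp le_refl.
case/and4P: st => _ bc' ncc' Hc.
have ba : par b a by rewrite par_sym.
have ac : par a c by rewrite par_sym.
have ac' : par a c'.
  apply/negP=> cac'.
  have : D b c = D b a.
    rewrite (D_forced (y' := c')); last by rewrite /forced1 bc bc' ncc'.
    by apply: D_forced; rewrite /forced1 bc' ba -(cmp_sym a) cac' cmp_ndj // cmp_sym.
  by rewrite (D_par ab) -E1; case: (D a b).
split=> //; apply/orP; left; rewrite /forced1 ac ac' ncc' /=.
case/or3P: Hc => [->//|dbc|dbc'].
- have dac : dj a c.
    apply: contraR nba => nac; rewrite /forced1 bc ba dbc orbT andbT /=.
    by rewrite dj_sym.
  by rewrite dac orbT.
- have [dac'|nac'] := boolP (dj a c'); first by rewrite !orbT.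
  case/negP: nba; have : D b c = D b a.
    rewrite (D_forced (y' := c')); last by rewrite /forced1 bc bc' ncc' dbc' !orbT.
    by apply: D_forced; rewrite /forced1 bc' ba dbc' orbT andbT /= dj_sym.
  by rewrite (D_par ab) -E1; case: (D a b).
Qed.

Lemma forced_acyclic a b c : ~~ cyclic3 forced par a b c.
Proof.
apply: lex_orient_acyclic; [exact: forced_sym|exact: forced_swap|exact: forced_consistent|
  exact: par_sym|exact: par_neq|exact: cyclic3_forced|exact: forced_cases].
Qed.

Let before (x y : T) : bool := par x y && D x y.

Lemma before_trans x y w : before x y -> before y w -> before x w.
Proof.
case/andP=> pxy Dxy /andP[pyw Dyw].
have pxw : par x w.
  apply/negP=> cxw.
  have : D y x = D y w.
    by apply: D_forced; rewrite /forced1 par_sym pxy pyw cxw cmp_ndj.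
  by rewrite (D_par pxy) Dxy Dyw.
rewrite /before pxw /=; apply: contraT => nDxw.
have : D w x by rewrite (D_par pxw).
move=> Dwx; case/negP: (forced_acyclic x y w).
by rewrite /cyclic3 pxy pyw par_sym pxw Dxy Dyw Dwx.
Qed.

Lemma before_irr x : before x x = false.
Proof. by rewrite /before /par /cmp le_refl. Qed.

Lemma before_total x y : par x y -> before x y || before y x.
Proof. by move=> p; rewrite /before p par_sym p (D_par p) /= orbN. Qed.

(** The intended strict comparisons of left ends, of right ends, and, for [far], of the right end of
    [x] with the left end of [y]. *)
Let lft (x y : T) : bool := before x y || (x != y) && le y x.
Let rgt (x y : T) : bool := before x y || (x != y) && le x y.
Let far (x y : T) : bool := before x y && dj x y.

Lemma before_le_par x y w : before x y -> cmp y w -> par x w -> before x w.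
Proof.
case/andP=> p d c pw; rewrite /before pw -(@D_forced x y w) //.
by rewrite /forced1 p pw c cmp_ndj.
Qed.

Lemma le_before_par x y w : cmp x w -> before x y -> par w y -> before w y.
Proof.
move=> c /andP[p d] pw; rewrite /before pw.
have := @D_forced y x w; rewrite /forced1 par_sym p par_sym pw c cmp_ndj // => /(_ isT).
by rewrite (D_par p) d (D_par pw) /= => /esym/negbFE.
Qed.

Lemma before_nle x y : before x y -> ~~ le x y /\ ~~ le y x.
Proof. by case/andP; rewrite /par negb_or => /andP[]. Qed.

Lemma lft_trans : transitive lft.
Proof.
move=> y x w; rewrite /lft; case/orP=> [bxy|/andP[nxy lyx]].
  case/orP=> [byw|/andP[nyw lwy]]; first by rewrite (before_trans bxy byw).
  have [nxy nyx] := before_nle bxy.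
  have [cxw|] := boolP (cmp x w); last first.
    by move=> p; rewrite (before_le_par bxy _ p) // /cmp lwy orbT.
  case/orP: cxw => [lxw|lwx]; first by case/negP: nxy; apply: le_trans lxw lwy.
  rewrite lwx andbT; case: eqP => [E|]; last by rewrite orbT.
  by rewrite -E in lwy; case/negP: nxy.
case/orP=> [byw|/andP[nyw lwy]].
  have [nyw nwy] := before_nle byw.
  have [cxw|] := boolP (cmp x w); last first.
    by move=> p; rewrite (le_before_par _ byw p) // /cmp lyx.
  case/orP: cxw => [lxw|lwx]; first by case/negP: nyw; apply: le_trans lyx lxw.
  rewrite lwx andbT; case: eqP => [E|]; last by rewrite orbT.
  by rewrite -E in nyw; case/negP: nyw.
rewrite (le_trans lwy lyx) andbT; case: eqP => [E|]; last by rewrite orbT.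
by subst w; rewrite (le_anti (x := y) (y := x)) ?eqxx // ?lwy ?lyx in nyw *.
Qed.

Lemma rgt_trans : transitive rgt.
Proof.
move=> y x w; rewrite /rgt; case/orP=> [bxy|/andP[nxy lxy]].
  case/orP=> [byw|/andP[nyw lyw]]; first by rewrite (before_trans bxy byw).
  have [nxy nyx] := before_nle bxy.
  have [cxw|] := boolP (cmp x w); last first.
    by move=> p; rewrite (before_le_par bxy _ p) // /cmp lyw.
  case/orP: cxw => [lxw|lwx]; last by case/negP: nyx; apply: le_trans lyw lwx.
  rewrite lxw andbT; case: eqP => [E|]; last by rewrite orbT.
  by rewrite -E in lyw; case/negP: nyx.
case/orP=> [byw|/andP[nyw lyw]].
  have [nyw nwy] := before_nle byw.
  have [cxw|] := boolP (cmp x w); last first.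
    by move=> p; rewrite (le_before_par _ byw p) // /cmp lxy orbT.
  case/orP: cxw => [lxw|lwx]; last by case/negP: nwy; apply: le_trans lwx lxy.
  rewrite lxw andbT; case: eqP => [E|]; last by rewrite orbT.
  by rewrite -E in nwy; case/negP: nwy.
rewrite (le_trans lxy lyw) andbT; case: eqP => [E|]; last by rewrite orbT.
by subst w; rewrite (le_anti (x := y) (y := x)) ?eqxx // ?lxy ?lyw in nyw *.
Qed.

Lemma lft_irr x : lft x x = false.
Proof. by rewrite /lft before_irr eqxx. Qed.

Lemma rgt_irr x : rgt x x = false.
Proof. by rewrite /rgt before_irr eqxx. Qed.

Lemma lft_total x y : x != y -> lft x y || lft y x.
Proof.
move=> xy; rewrite /lft (eq_sym y) xy /=.
have [/orP[] ->|/before_total/orP[]->] := boolP (cmp x y); by rewrite ?orbT.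
Qed.

Lemma rgt_total x y : x != y -> rgt x y || rgt y x.
Proof.
move=> xy; rewrite /rgt (eq_sym y) xy /=.
have [/orP[] ->|/before_total/orP[]->] := boolP (cmp x y); by rewrite ?orbT.
Qed.

(** With [rgt_far] and the two transitivity lemmas, this makes the comparisons of all end points one
    linear order, so counting predecessors yields coordinates. *)
Lemma far_lft x y w : far x y -> lft y w -> far x w.
Proof.
case/andP=> bxy dxy; case/orP=> [byw|/andP[_ lwy]].
  have bxw := before_trans bxy byw; rewrite /far bxw /=.
  apply: contraT => ndxw; case/andP: (bxy) => pxy _; case/andP: (byw) => pyw Dyw.
  have : D y x = D y w.
    by apply: D_forced; rewrite /forced1 par_sym pxy pyw ndxw (dj_sym y x) dxy !orbT.
  case/andP: bxy => _ Dxy.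
  by rewrite (D_par pxy) Dxy Dyw.
have dxw : dj x w by rewrite dj_sym; apply: dj_down lwy _; rewrite dj_sym.
by rewrite /far dxw (before_le_par bxy _ (dj_par dxw)) // /cmp lwy orbT.
Qed.

Lemma rgt_far x y w : rgt w x -> far x y -> far w y.
Proof.
move=> rwx /andP[bxy dxy]; case/orP: rwx => [bwx|/andP[_ lwx]].
  have bwy := before_trans bwx bxy; rewrite /far bwy /=.
  apply: contraT => ndwy; case/andP: (bwx) => pwx Dwx; case/andP: (bxy) => pxy Dxy.
  have : D x y = D x w.
    by apply: D_forced; rewrite /forced1 par_sym in pwx *;
      rewrite pxy pwx dxy (dj_sym y) ndwy !orbT.
  by rewrite (D_par pwx) Dxy Dwx.
have dwy : dj w y by apply: dj_down lwx dxy.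
by rewrite /far dwy (le_before_par _ bxy (dj_par dwy)) // /cmp lwx orbT.
Qed.

(* The number of end points preceding the left end of [y] (resp. the right end
   of [x]); [far w y] means that [w] ends before [y] starts. *)
Let l (y : T) : nat := #|[set w | lft w y]| + #|[set w | far w y]|.
Let r (x : T) : nat := #|[set w | rgt w x]| + #|[set w | ~~ far x w]|.

Lemma far_r_l w y : far w y -> r w < l y.
Proof.
move=> f; rewrite /r /l [X in X < _]addnC -addnS; apply: leq_add.
  apply/subset_leq_card/fintype.subsetP=> v; rewrite !inE => nf.
  have [E|nvy] := eqVneq v y; first by rewrite E f in nf.
  by case/orP: (lft_total nvy) => // h; rewrite (far_lft f h) in nf.
apply: proper_card; apply/fintype.properP; split.
  by apply/fintype.subsetP=> v; rewrite !inE => h; apply: rgt_far h f.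
by exists w; rewrite !inE ?rgt_irr.
Qed.

Lemma nfar_l_r w y : ~~ far w y -> l y < r w.
Proof.
move=> f; rewrite /r /l -addSn [X in _ <= X]addnC; apply: leq_add.
  apply: proper_card; apply/fintype.properP; split; last by exists y; rewrite !inE ?lft_irr.
  apply/fintype.subsetP=> v; rewrite !inE => h; apply: contra f => h'.
  exact: far_lft h' h.
apply/subset_leq_card/fintype.subsetP=> v; rewrite !inE => h.
have [E|nvw] := eqVneq v w; first by rewrite -E h in f.
by case/orP: (rgt_total nvw) => // h'; rewrite (rgt_far h' h) in f.
Qed.

Lemma lft_l x y : lft x y -> l x < l y.
Proof.
move=> h; rewrite /l -addSn; apply: leq_add.
  apply: proper_card; apply/fintype.properP; split; last by exists x; rewrite !inE ?lft_irr.
  by apply/fintype.subsetP=> v; rewrite !inE => h'; apply: lft_trans h' h.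
by apply/subset_leq_card/fintype.subsetP=> v; rewrite !inE => h'; apply: far_lft h' h.
Qed.

Lemma rgt_r x y : rgt x y -> r x < r y.
Proof.
move=> h; rewrite /r -addSn; apply: leq_add.
  apply: proper_card; apply/fintype.properP; split; last by exists x; rewrite !inE ?rgt_irr.
  by apply/fintype.subsetP=> v; rewrite !inE => h'; apply: rgt_trans h' h.
apply/subset_leq_card/fintype.subsetP=> v; rewrite !inE; apply: contra.
exact: rgt_far.
Qed.

Lemma interval_realizer : exists l r : T -> nat,
  [/\ forall x, l x < r x,
      forall x y, le x y = (l y <= l x) && (r x <= r y) &
      forall x y, dj x y = (r x < l y) || (r y < l x)].
Proof.
exists l, r; split=> [x|x y|x y].
- by apply: nfar_l_r; rewrite /far before_irr.
- have [->|nxy] := eqVneq x y; first by rewrite le_refl !leqnn.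
  apply/idP/idP => [lxy|/andP[ll lr]].
    apply/andP; split; apply: ltnW; last by apply: rgt_r; rewrite /rgt nxy lxy orbT.
    by apply: lft_l; rewrite /lft eq_sym nxy lxy orbT.
  have nl : ~~ lft x y by apply: contraL ll => /lft_l; rewrite ltnNge.
  have nr : ~~ rgt y x by apply: contraL lr => /rgt_r; rewrite ltnNge.
  case/orP: (rgt_total nxy) => [/orP[b|/andP[]//]|h]; last by rewrite h in nr.
  by rewrite /lft b in nl.
have farE u v : far u v = (r u < l v).
  have [/far_r_l->//|/nfar_l_r h] := boolP (far u v).
  by rewrite ltnNge (ltnW h).
rewrite -!farE /far (dj_sym y) -andb_orl.
have [dxy|//] := boolP (dj x y); last by rewrite andbF.
by rewrite before_total // dj_par.
Qed.

End IntervalRealizer.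

(** * Neighbourhood inclusion and circular pairs *)

Section Neighbourhoods.
Variable G : lgraph.
Implicit Types u v w x y z : G.

Definition nbh_le u v : bool := closed_nbh u \subset closed_nbh v.

Definition incomp u v : bool := ~~ nbh_le u v && ~~ nbh_le v u.

Lemma in_nbh u v : (v \in closed_nbh u) = adj u v.
Proof.
by rewrite /closed_nbh /open_nbh !inE; case: eqP => // ->; rewrite adj_refl.
Qed.

Lemma nbh_leP u v : reflect (forall w, adj u w -> adj v w) (nbh_le u v).
Proof.
apply: (iffP fintype.subsetP) => h w; first by have := h w; rewrite !in_nbh.
by rewrite !in_nbh; apply: h.
Qed.

Lemma nbh_le_refl : reflexive nbh_le. Proof. by move=> u; apply: subxx. Qed.

Lemma nbh_le_trans : transitive nbh_le.
Proof. by move=> v u w; apply: fintype.subset_trans. Qed.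

Lemma nbh_le_adj u v : nbh_le u v -> adj u v.
Proof. by move/nbh_leP/(_ u (adj_refl u)); rewrite adj_sym. Qed.

Lemma incomp_sym : symmetric incomp.
Proof. by move=> u v; rewrite /incomp andbC. Qed.

Lemma incomp_irr u : incomp u u = false.
Proof. by rewrite /incomp nbh_le_refl. Qed.

Lemma nonadj_incomp u v : ~~ adj u v -> incomp u v.
Proof.
move=> n; apply/andP; split; apply: contra n; last rewrite adj_sym; exact: nbh_le_adj.
Qed.

Lemma inclusion_edgeE u v : inclusion_edge u v = nbh_le u v || nbh_le v u.
Proof.
rewrite /inclusion_edge -/(nbh_le u v) -/(nbh_le v u) andb_idl //.
by case/orP=> /nbh_le_adj //; rewrite adj_sym.
Qed.

Lemma overlap_edgeE u v : overlap_edge u v = adj u v && incomp u v.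
Proof. by rewrite /overlap_edge inclusion_edgeE negb_or. Qed.

Lemma overlap_sym : symmetric (@overlap_edge G).
Proof. by move=> u v; rewrite !overlap_edgeE adj_sym incomp_sym. Qed.

Lemma spanning_pairP u v : reflect
  ((forall x, ~~ adj v x -> nbh_le x u) /\ (forall y, ~~ adj u y -> nbh_le y v))
  (spanning_pair u v).
Proof.
apply: (iffP andP) => -[/= h1 h2]; split.
- by move=> x nx; have := forallP h1 x; rewrite in_nbh nx.
- by move=> x nx; have := forallP h2 x; rewrite in_nbh nx.
- by apply/forallP=> x; rewrite in_nbh; apply/implyP/h1.
- by apply/forallP=> x; rewrite in_nbh; apply/implyP/h2.
Qed.

Lemma spanning_sym u v : spanning_pair u v = spanning_pair v u.
Proof. by rewrite /spanning_pair andbC. Qed.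

Lemma spanning_le u v w : spanning_pair u v -> nbh_le v w -> spanning_pair u w.
Proof.
move=> /spanning_pairP[h1 h2] l; apply/spanning_pairP; split=> x nx.
  by apply: h1; apply: contra nx; move/nbh_leP: l; apply.
exact: nbh_le_trans (h2 _ nx) l.
Qed.

Lemma circular_pair_sym u v : circular_pair u v = circular_pair v u.
Proof. by rewrite /circular_pair spanning_sym adj_sym. Qed.

(** Non-neighbours are incomparable and overlapping means adjacent and incomparable, so clause (i)
    of avoidance amounts to incomparability with both ends. *)
Lemma avoids_edgeE z x y : avoids_edge z x y =
  [&& incomp z x, incomp z y &
    (overlap_edge z x && overlap_edge z y ==> ~~ overlap_edge x y)].
Proof.
have iE u v : (adj u v ==> overlap_edge u v) = incomp u v.
  rewrite overlap_edgeE; have [a|n] := boolP (adj u v) => //=.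
  by rewrite nonadj_incomp.
by rewrite /avoids_edge /avoids /= !iE !andbT andbA.
Qed.

(* One move of a pair of walks avoiding each other and [z]: a walk advances
   while the other one stays put. *)
Definition advance1 z x y y' : bool :=
  [&& avoids_edge z x x, adj y y', avoids_edge z y y' & avoids_edge x y y'].

Definition advance z (p q : G * G) : bool :=
  (p.1 == q.1) && advance1 z p.1 p.2 q.2 || (p.2 == q.2) && advance1 z p.2 p.1 q.1.

Lemma avoids_edge_sym z x y : avoids_edge z x y = avoids_edge z y x.
Proof.
rewrite !avoids_edgeE (overlap_sym y) (andbC (overlap_edge z y)).
by case: (incomp z x); case: (incomp z y).
Qed.

Lemma avoids_edge_id z x : avoids_edge z x x = incomp z x.
Proof.
by rewrite avoids_edgeE andbA andbb (overlap_edgeE x) incomp_irr andbF implybT andbT.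
Qed.

Lemma advance_sym z : symmetric (advance z).
Proof.
have s x y y' : advance1 z x y y' = advance1 z x y' y.
  by rewrite /advance1 adj_sym !(avoids_edge_sym _ y').
move=> [x y] [x' y']; rewrite /advance /= (eq_sym x') (eq_sym y').
by congr (_ || _); case: eqP => //= <-; rewrite s.
Qed.

Lemma advance_swap z x y x' y' : advance z (x, y) (x', y') -> advance z (y, x) (y', x').
Proof. by rewrite /advance /= orbC. Qed.

Lemma advance1E z x y y' : advance1 z x y y' =
  [&& incomp z x, incomp z y, incomp z y', incomp x y, incomp x y', adj y y',
    (overlap_edge z y && overlap_edge z y' ==> ~~ overlap_edge y y') &
    (overlap_edge x y && overlap_edge x y' ==> ~~ overlap_edge y y')].
Proof.
rewrite /advance1 avoids_edge_id !avoids_edgeE.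
by case: (incomp z x); case: (adj y y'); case: (incomp z y);
  case: (incomp z y'); case: (incomp x y); case: (incomp x y'); rewrite //= ?andbF.
Qed.

Lemma advance_edges z x y x' y' : advance z (x, y) (x', y') ->
  [/\ avoids_edge z x x', avoids_edge z y y', adj x x' & adj y y'] /\
  (avoids_edge x y y' /\ avoids_edge y' x x').
Proof.
rewrite /advance /=; case/orP=> /andP[/eqP <-] /and4P[a1 a2 a3 a4].
  by split; split=> //; rewrite ?adj_refl // avoids_edge_id;
    move: a4; rewrite avoids_edgeE => /and3P[_]; rewrite incomp_sym.
split; split=> //; rewrite ?adj_refl // avoids_edge_id.
by move: a4; rewrite avoids_edgeE => /and3P[]; rewrite incomp_sym.
Qed.

Lemma avoids_sorted z x s : incomp z x ->
  path (fun u v => avoids_edge z u v) x s -> avoids z (x :: s).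
Proof.
have iE u v : (adj u v ==> overlap_edge u v) = incomp u v.
  rewrite overlap_edgeE; have [a|n] := boolP (adj u v) => //=.
  by rewrite nonadj_incomp.
elim: s x => [|y s IH] x zx /=; first by rewrite /avoids /= iE zx.
case/andP=> e p; move: (e); rewrite avoids_edgeE => /and3P[_ zy o].
have := IH y zy p; rewrite /avoids /= => /andP[-> ->].
by rewrite iE zx o.
Qed.

(** The two coordinates of a path of moves are the two walks; a coordinate at rest walks along a
    loop. *)
Lemma connect_advance_invertible z x y : x != y ->
  connect (advance z) (x, y) (y, x) -> invertible_pair z x y.
Proof.
move=> xy /connectP[s p el].
have [zx zy] : incomp z x /\ incomp z y.
  case: s p el => [_ [E]|[u v] s /andP[/advance_edges[[e1 e2 _ _] _] _] _].
    by rewrite E eqxx in xy.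
  by move: e1 e2; rewrite !avoids_edgeE => /and3P[-> _ _] /and3P[-> _ _].
split; first by split=> //; [apply: contraTneq zx|apply: contraTneq zy] => ->; rewrite incomp_irr.
have map_path1 (r : rel G) : (forall u v u' v', advance z (u, v) (u', v') -> r u u') ->
    path r x (map fst s).
  move=> h; apply: (@homo_path _ _ fst (advance z) r (x, y)) p => -[u v] [u' v']; exact: h.
have map_path2 (r : rel G) : (forall u v u' v', advance z (u, v) (u', v') -> r v v') ->
    path r y (map snd s).
  move=> h; apply: (@homo_path _ _ snd (advance z) r (x, y)) p => -[u v] [u' v']; exact: h.
exists (x :: map fst s), (y :: map snd s); split.
- rewrite /walk_between eqxx (@last_map _ _ fst s (x, y)) -el eqxx andbT /=.
  by apply: map_path1 => u v u' v' /advance_edges[[]].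
- rewrite /walk_between eqxx (@last_map _ _ snd s (x, y)) -el eqxx andbT /=.
  by apply: map_path2 => u v u' v' /advance_edges[[]].
- split; first by rewrite /= !size_map.
  move=> d i; rewrite /= size_map ltnS => lti.
  have {p} := elimT (pathP (d, d)) p i lti.
  have fstE j : j < size ((x, y) :: s) -> nth d (x :: map fst s) j = (nth (d, d) ((x, y) :: s) j).1.
    by move=> ltj; rewrite -(nth_map _ d fst ltj).
  have sndE j : j < size ((x, y) :: s) -> nth d (y :: map snd s) j = (nth (d, d) ((x, y) :: s) j).2.
    by move=> ltj; rewrite -(nth_map _ d snd ltj).
  rewrite (fstE i) ?(sndE i) ?ltnS 1?ltnW //.
  rewrite (nth_map (d, d)) // (nth_map (d, d)) //.
  by case: (nth _ (_ :: s) i) (nth _ s i) => [u v] [u' v'] /advance_edges[_].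
- apply: avoids_sorted => //; apply: map_path1 => u v u' v' /advance_edges[[]] //.
- apply: avoids_sorted => //; apply: map_path2 => u v u' v' /advance_edges[[]] //.
Qed.

End Neighbourhoods.

(** * Circularly paired graphs as posets with an order-reversing involution *)

Section CircularlyPaired.
Variable H : lgraph.
Hypothesis no_twins : forall u v : H, u != v -> ~~ true_twins u v.
Hypothesis paired : circularly_paired H.
Implicit Types u v w x y z : H.

Local Notation le := (@nbh_le H).

(** When the graph is circularly paired the default [u] is never returned. *)
Definition copair u : H := odflt u [pick v | circular_pair u v].

Lemma copairP u : circular_pair u (copair u).
Proof.
rewrite /copair; case: pickP => //= h.
by have [v] := paired u; rewrite h.
Qed.

Lemma nbh_le_anti : antisymmetric le.
Proof.
move=> u v h; apply/eqP; apply: contraT => /no_twins.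
by rewrite /true_twins finset.eqEsubset; move: h; rewrite /nbh_le => ->.
Qed.

Lemma copair_nonadj u : ~~ adj u (copair u).
Proof. by case/andP: (copairP u). Qed.

Lemma nonadj_le_copair u v : ~~ adj u v -> le v (copair u).
Proof. by case/andP: (copairP u) => /spanning_pairP[_ h] _; apply: h. Qed.

Lemma adjE u v : adj u v = ~~ le u (copair v).
Proof.
apply/idP/idP; last by apply: contraR; rewrite adj_sym; apply: nonadj_le_copair.
move=> a; apply/nbh_leP=> h; have := copair_nonadj v.
by rewrite adj_sym h.
Qed.

(** Both [u] and its double partner are non-adjacent to [copair u], so each lies below the other,
    and there are no twins. *)
Lemma copairK : involutive copair.
Proof.
move=> u; apply: nbh_le_anti; apply/andP; split.
  case/andP: (copairP u) => /spanning_pairP[h _] _; apply: h.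
  exact: copair_nonadj.
by apply: nonadj_le_copair; rewrite adj_sym copair_nonadj.
Qed.

Lemma le_copair2 u v : le (copair v) (copair u) = le u v.
Proof.
have h a b : le a b -> le (copair b) (copair a).
  move=> /nbh_leP l; apply: nonadj_le_copair; apply: contra (copair_nonadj b).
  exact: l.
by apply/idP/idP => /h //; rewrite !copairK.
Qed.

Lemma le_copairC u v : le u (copair v) = le v (copair u).
Proof. by rewrite -le_copair2 copairK. Qed.

Lemma copair_leC u v : le (copair u) v = le (copair v) u.
Proof. by rewrite -le_copair2 copairK. Qed.

Lemma nle_copair u : ~~ le u (copair u).
Proof. by rewrite -adjE adj_refl. Qed.

Lemma ncopair_le u : ~~ le (copair u) u.
Proof. by rewrite -{2}(copairK u) nle_copair. Qed.

Lemma spanningE u v : spanning_pair u v = le (copair u) v.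
Proof.
apply/spanning_pairP/idP => [[_]|l]; first by apply; exact: copair_nonadj.
split=> x; rewrite adj_sym adjE negbK => h.
  by apply: nbh_le_trans h _; rewrite copair_leC.
exact: nbh_le_trans h l.
Qed.

End CircularlyPaired.

(** * From intervals to arcs *)

Section Arcs.
Import Order.TTheory GRing.Theory Num.Theory.
Local Open Scope ring_scope.
Variable R : realType.

Lemma arc_meetP (a b c d : R) : a <= b -> c <= d ->
  (Defs.arc a b `&` Defs.arc c d !=set0)%classic <->
  exists k : int, c + k%:~R <= b /\ a <= d + k%:~R.
Proof.
move=> ab cd; split=> [[t [[k1 /andP[h1 h2]] [k2 /andP[h3 h4]]]]|[k [h1 h2]]].
  by exists (k1 - k2); rewrite intrB; split; lra.
exists (Num.max a (c + k%:~R)); split.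
  by exists 0; rewrite addr0 le_max lexx /= ge_max ab h1.
exists (- k); rewrite mulrNz lerBrDr le_max lexx orbT /= lerBlDr ge_max h2 /=.
by rewrite lerD2r.
Qed.

(** With end points in multiples of [1/N], meeting becomes a question about integers modulo [N]. *)
Lemma arc_meet_ratP (N : nat) (a b c d : int) : (0 < N)%N -> a <= b -> c <= d ->
  (Defs.arc (a%:~R / N%:R : R) (b%:~R / N%:R) `&` Defs.arc (c%:~R / N%:R) (d%:~R / N%:R) !=set0)%classic
  <-> exists k : int, c + k * N%:Z <= b /\ a <= d + k * N%:Z.
Proof.
move=> N0 ab cd.
have N0' : 0 < N%:R :> R by rewrite ltr0n.
have NE (k : int) : k%:~R = (k * N%:Z)%:~R / N%:R :> R.
  by rewrite intrM mulfK // lt0r_neq0.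
have leE (x y : int) : (x%:~R / N%:R <= y%:~R / N%:R :> R) = (x <= y).
  by rewrite ler_pM2r ?invr_gt0 // ler_int.
rewrite arc_meetP ?leE //; split=> -[k [h1 h2]]; exists k.
  by move: h1 h2; rewrite NE -!mulrDl -!intrD !leE.
by rewrite NE -!mulrDl -!intrD !leE.
Qed.

Section FromIntervals.
Variable H : lgraph.
Hypothesis no_twins : forall u v : H, u != v -> ~~ true_twins u v.
Hypothesis paired : circularly_paired H.
Variables (S : pred H) (l r : H -> nat).
Hypothesis S_cover : forall x, S x || S (copair x).
Hypothesis S_ncover : forall x y, S x -> S y -> ~~ nbh_le (copair x) y.
Hypothesis lr : forall x, S x -> (l x < r x)%N.
Hypothesis leE : forall x y, S x -> S y ->
  nbh_le x y = (l y <= l x)%N && (r x <= r y)%N.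
Hypothesis adjE' : forall x y, S x -> S y ->
  ~~ adj x y = (r x < l y)%N || (r y < l x)%N.

Lemma circular_arc_of_intervals : circular_arc_graph R H.
Proof.
have [N rN] : exists N, forall x, ((r x).*2 + 4 <= N)%N.
  exists ((\max_x r x).*2 + 4)%N => x.
  by rewrite leq_add2r leq_double (leq_bigmax x).
(* Doubling frees the odd positions, so the complement of [[2l, 2r]] on a circle of length [N] can
   be the closed arc [[2r + 1, 2l - 1 + N]]. *)
pose lo x : int := if S x then (l x).*2%:Z else (r (copair x)).*2%:Z + 1.
pose hi x : int := if S x then (r x).*2%:Z else (l (copair x)).*2%:Z - 1 + N%:Z.
have lohi x : lo x <= hi x.
  rewrite /lo /hi; have := S_cover x; case: ifP => [Sx _|_ /= Sx].
    by have := lr Sx; lia.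
  by have := rN (copair x); have := lr Sx; lia.
exists (fun x => (lo x)%:~R / N%:R), (fun x => (hi x)%:~R / N%:R); split=> [u|u v].
  by rewrite ler_wpM2r ?invr_ge0 ?ler0n // ler_int lohi.
rewrite arc_meet_ratP ?lohi //; last by have := rN u; lia.
have mixed x y : S x -> ~~ S y ->
    adj x y <-> exists k : int, lo y + k * N%:Z <= hi x /\ lo x <= hi y + k * N%:Z.
  move=> Sx nSy; have := S_cover y; rewrite (negPf nSy) /= => Sy'.
  rewrite (adjE paired) leE // /lo /hi Sx (negPf nSy).
  have := rN x; have := rN (copair y); have := lr Sx; have := lr Sy'.
  move: (l x) (r x) (l (copair y)) (r (copair y)) => a b c d h1 h2 h3 h4.
  split=> [|[k []]].
    rewrite negb_and -!ltnNge => /orP[h|h]; [exists (-1)|exists 0]; split; lia.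
  move=> k1 k2; rewrite negb_and -!ltnNge.
  (* [N] exceeds all interval ends, so only the translates by [-1] and [0] can meet. *)
  have [k3|k3|k3] : [\/ k <= -2, k = -1 \/ k = 0 | k >= 1].
    by have [?|?] := leP k (-2); [constructor 1|have [?|?] := leP 1 k; [constructor 3|constructor 2; lia]].
  - have : k * N%:Z <= -2 * N%:Z by rewrite ler_pM2r //; lia.
    by lia.
  - by case: k3 => ->  in k1 k2 *; lia.
  - have : 1 * N%:Z <= k * N%:Z by rewrite ler_pM2r //; lia.
    by lia.
have [Su|nSu] := boolP (S u); have [Sv|nSv] := boolP (S v).
- rewrite /lo /hi Su Sv.
  rewrite -(negbK (adj u v)) adjE' // negb_or -!leqNgt.
  have := rN u; have := rN v; have := lr Su; have := lr Sv.
  move: (l u) (r u) (l v) (r v) => a b c d h1 h2 h3 h4.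
  split=> [/andP[??]|[k [k1 k2]]]; first by exists 0; split; lia.
  have [k3|k3|k3] : [\/ k <= -1, k = 0 | k >= 1].
    by have [?|?] := leP k (-1); [constructor 1|have [?|?] := leP 1 k; [constructor 3|constructor 2; lia]].
  - have : k * N%:Z <= -1 * N%:Z by rewrite ler_pM2r //; lia.
    by lia.
  - by subst k; lia.
  - have : 1 * N%:Z <= k * N%:Z by rewrite ler_pM2r //; lia.
    by lia.
- exact: mixed.
- rewrite adj_sym mixed //; split=> -[k [k1 k2]]; exists (- k); lia.
(* Two complemented arcs both contain position [N - 1]; the vertices are adjacent by [S_ncover]. *)
- have := S_cover u; have := S_cover v; rewrite (negPf nSu) (negPf nSv) /= => Sv' Su'.
  rewrite (adjE paired) -[X in nbh_le X _](copairK no_twins paired).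
  rewrite S_ncover //; split=> // _; exists 0; rewrite /lo /hi (negPf nSu) (negPf nSv).
  have := rN (copair u); have := rN (copair v); have := lr Su'; have := lr Sv'; lia.
Qed.

End FromIntervals.
End Arcs.

(** * Orientations anchored at a minimal vertex *)

Section AnchoredOrientation.
Variable H : lgraph.
Hypothesis no_twins : forall u v : H, u != v -> ~~ true_twins u v.
Hypothesis paired : circularly_paired H.
Variable z : H.
Hypothesis z_min : forall w, nbh_le w z -> w = z.
Hypothesis no_invertible : forall x y, ~ invertible_pair z x y.
Implicit Types u v w x y : H.

Local Notation le := (@nbh_le H).
Local Notation bar := (@copair H).
Local Notation ov := (@overlap_edge H).
Local Notation D := (lex_orient (advance z)).

Let barK : involutive bar := copairK no_twins paired.
Let adj_bar u v : adj u v = ~~ le u (bar v) := adjE paired u v.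

Lemma anchored_orient_eq x y y' : advance1 z x y y' -> D x y = D x y'.
Proof.
move=> s; apply: (lex_orient_eq (advance_sym z)); apply: connect1.
by rewrite /advance /= eqxx s.
Qed.

(** A class of moves containing its own reversal would be an invertible pair anchored at [z]. Here
    [D] serves as a choice between each class and its reversal. *)
Lemma anchored_orientN x y : incomp x y -> D y x = ~~ D x y.
Proof.
move=> i; apply: lex_orientN; [exact: advance_sym|exact: advance_swap| |].
  by move=> u v uv; apply/negP => /(connect_advance_invertible uv)/no_invertible.
by apply: contraTneq i => ->; rewrite incomp_irr.
Qed.

Lemma advance1_cmp x y y' : incomp z x -> incomp z y -> incomp z y' ->
  incomp x y -> incomp x y' -> le y y' || le y' y -> advance1 z x y y'.
Proof.
move=> zx zy zy' xy xy' c; rewrite advance1E zx zy zy' xy xy' /=.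
have no : ~~ ov y y' by rewrite overlap_edgeE /incomp -negb_or c andbF.
rewrite (negPf no) !implybT !andbT.
by case/orP: c => /nbh_le_adj //; rewrite adj_sym.
Qed.

Lemma incomp_bar x : incomp x (bar x).
Proof. by apply: nonadj_incomp; apply: copair_nonadj. Qed.

Lemma incomp_zbar : incomp z (bar z).
Proof. exact: incomp_bar. Qed.

Section Crossing.
Variable w : H.
Hypothesis zw : ov z w.

Lemma crossing_incomp : incomp z w.
Proof. by move: zw; rewrite overlap_edgeE => /andP[]. Qed.

Lemma crossing_adj : adj z w.
Proof. by move: zw; rewrite overlap_edgeE => /andP[]. Qed.

Lemma crossing_adj_bar : adj z (bar w).
Proof. by rewrite adj_bar barK; case/andP: crossing_incomp. Qed.

(** If [bar z] were below [w], then [bar w] would be below [z], hence equal to it by minimality,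
    although [w] is adjacent to [z]. *)
Lemma crossing_incomp_zbar : incomp w (bar z).
Proof.
apply/andP; split; first by rewrite -adj_bar adj_sym crossing_adj.
rewrite (copair_leC no_twins paired); apply/negP => /z_min => e.
by have := crossing_adj; rewrite -[w]barK e (negPf (copair_nonadj paired z)).
Qed.

Lemma crossing_incomp_bar : incomp z (bar w).
Proof.
apply/andP; split.
  by rewrite (le_copairC no_twins paired); case/andP: crossing_incomp_zbar.
by rewrite (copair_leC no_twins paired); case/andP: crossing_incomp_zbar.
Qed.

Lemma crossing_bar : ov z (bar w).
Proof. by rewrite overlap_edgeE crossing_adj_bar crossing_incomp_bar. Qed.

(** Moving from [bar z] to [bar w] is allowed: [z] misses [bar z] and [w] misses [bar w], so the
    overlap clauses are vacuous. *)
Lemma orient_zbar_bar : D w (bar z) = D w (bar w).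
Proof.
apply: anchored_orient_eq.
rewrite advance1E crossing_incomp incomp_zbar crossing_incomp_bar.
rewrite crossing_incomp_zbar incomp_bar /=.
rewrite adj_bar barK.
rewrite [ov z (bar z)]overlap_edgeE (negPf (copair_nonadj paired z)) /=.
rewrite [ov w (bar w)]overlap_edgeE (negPf (copair_nonadj paired w)) /= andbF andbT.
by case/andP: crossing_incomp_zbar.
Qed.

Lemma orient_zbar_cmp y : D w (bar z) -> incomp z y -> incomp w y ->
  le y (bar w) || le (bar w) y -> D w y.
Proof.
move=> d zy wy c; rewrite orient_zbar_bar in d.
rewrite (@anchored_orient_eq w y (bar w)) //.
by apply: advance1_cmp; rewrite ?crossing_incomp ?crossing_incomp_bar ?incomp_bar.
Qed.

End Crossing.

(** Each of [w] and [bar w] is oriented towards [bar z] as towards the other, so exactly one of them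
    enters the section. *)
Lemma orient_bar w : ov z w -> D (bar w) (bar z) = ~~ D w (bar z).
Proof.
move=> zw; rewrite (orient_zbar_bar zw) (orient_zbar_bar (crossing_bar zw)) barK.
by rewrite anchored_orientN // incomp_bar.
Qed.

(* The arcs missing the right end point of [z]. *)
Definition section w : bool := incomp z w && (~~ adj z w || D w (bar z)).

Lemma section_incomp w : section w -> incomp z w.
Proof. by case/andP. Qed.

Lemma section_crossing w : section w -> adj z w -> ov z w /\ D w (bar z).
Proof. by rewrite overlap_edgeE => /andP[-> /orP[/negPf->//|->]] ->. Qed.

Lemma section_cover w : section w || section (bar w).
Proof.
have [i|] := boolP (incomp z w).
  have [a|n] := boolP (adj z w); last by rewrite /section i n.
  have zw : ov z w by rewrite overlap_edgeE a i.
  rewrite /section i a (crossing_incomp_bar zw) (orient_bar zw) /=.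
  by case: (D w (bar z)); rewrite ?orbT.
rewrite /incomp negb_and !negbK => h.
suff n : ~~ adj z (bar w) by rewrite orbC /section nonadj_incomp // n.
rewrite adj_bar barK negbK; case/orP: h => // /z_min ->; exact: nbh_le_refl.
Qed.

(** If [x] and [y] covered the circle, both would cross [z], and comparing each with the complement
    of the other would give [D x y] as well as [D y x]. *)
Lemma section_ncover x y : section x -> section y -> ~~ le (bar x) y.
Proof.
move=> sx sy; apply/negP=> l.
have ixy : incomp x y.
  apply/andP; split; apply/negP => l'.
    have := ncopair_le no_twins paired y; rewrite (nbh_le_trans _ l) //.
    by rewrite (le_copair2 no_twins paired).
  by have := ncopair_le no_twins paired x; rewrite (nbh_le_trans l l').
have zy := section_incomp sy; have zx := section_incomp sx.
have l2 : le (bar y) x by rewrite (copair_leC no_twins paired).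
have [ax|nx] := boolP (adj z x); last first.
  case/andP: zy => /negP[]; apply: nbh_le_trans l.
  by apply: nonadj_le_copair => //; rewrite adj_sym.
have [ay|ny] := boolP (adj z y); last first.
  case/andP: zx => /negP[]; apply: nbh_le_trans l2.
  by apply: nonadj_le_copair => //; rewrite adj_sym.
have [ox dx] := section_crossing sx ax; have [oy dy] := section_crossing sy ay.
have := orient_zbar_cmp ox dx zy ixy; rewrite l orbT => /(_ isT) Dxy.
have := orient_zbar_cmp oy dy zx; rewrite incomp_sym ixy l2 orbT => /(_ isT isT).
by rewrite anchored_orientN // Dxy.
Qed.

Lemma section_crossing_adj x y : section x -> section y -> adj z x -> adj z y -> adj x y.
Proof.
move=> sx sy ax ay; apply: contraT => n.
have [ox dx] := section_crossing sx ax; have [oy dy] := section_crossing sy ay.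
have zy := section_incomp sy; have zx := section_incomp sx.
have ixy := nonadj_incomp n.
have l : le y (bar x) by apply: nonadj_le_copair.
have l2 : le x (bar y) by apply: nonadj_le_copair => //; rewrite adj_sym.
have := orient_zbar_cmp ox dx zy ixy; rewrite l => /(_ isT) Dxy.
have := orient_zbar_cmp oy dy zx; rewrite incomp_sym ixy l2 => /(_ isT isT).
by rewrite anchored_orientN // Dxy.
Qed.

Lemma section_below x y : section x -> section y -> ~~ adj z x -> adj z y ->
  incomp x y -> D x y = false.
Proof.
move=> sx sy nx ay i; have [oy dy] := section_crossing sy ay.
have iyz : incomp y (bar z) by apply: crossing_incomp_zbar.
rewrite incomp_sym in i.
rewrite anchored_orientN // (@anchored_orient_eq y x (bar z)) ?dy //.
apply: advance1_cmp; rewrite ?incomp_zbar ?section_incomp //.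
by rewrite nonadj_le_copair.
Qed.

(** A forcing is a single move unless [z] overlaps both [y] and [y'] and these overlap each other.
    In that case [x] misses [z], and [section_below] fixes both orientations. *)
Lemma section_forced x y y' : section x -> section y -> section y' ->
  incomp x y -> incomp x y' -> adj y y' ->
  [|| le y y', le y' y, ~~ adj x y | ~~ adj x y'] -> D x y = D x y'.
Proof.
move=> sx sy sy' xy xy' a c.
have [|] := boolP [&& ov z y, ov z y' & ov y y']; last first.
  move=> nc; apply: anchored_orient_eq.
  rewrite advance1E !section_incomp // xy xy' a /=.
  apply/andP; split; first by move: nc; case: (ov z y); case: (ov z y').
  apply/implyP=> /andP[o o']; case/or4P: c.
  - by move=> l; rewrite overlap_edgeE /incomp l andbF.
  - by move=> l; rewrite overlap_edgeE /incomp l !andbF.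
  - by move: o; rewrite overlap_edgeE => /andP[->].
  - by move: o'; rewrite overlap_edgeE => /andP[->].
case/and3P=> oy oy' oyy'.
have ay := crossing_adj oy; have ay' := crossing_adj oy'.
have nx : ~~ adj z x.
  apply/negP=> ax; move: oyy'; rewrite overlap_edgeE a /incomp.
  by case/or4P: c => [->|->||]; rewrite ?andbF //; rewrite section_crossing_adj.
by rewrite !section_below.
Qed.

End AnchoredOrientation.

Lemma circular_arc_of_no_invertible (R : realType) (H : lgraph) :
  (forall u v : H, u != v -> ~~ true_twins u v) -> circularly_paired H ->
  ~ has_anchored_invertible_pair H -> circular_arc_graph R H.
Proof.
move=> no_twins paired no_inv.
have [h0 _|H0] := pickP H; last first.
  by exists (fun=> 0%R), (fun=> 0%R); split=> u; have := H0 u.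
have [z _ zmin] := arg_minnP (fun h : H => #|closed_nbh h|) (erefl : xpredT h0).
have z_min w : nbh_le w z -> w = z.
  move=> l; apply: (nbh_le_anti no_twins); rewrite l /=.
  have := zmin w isT; rewrite (geq_leqif (subset_leqif_card l)).
  by [].
have no_z x y : ~ invertible_pair z x y by move=> i; apply: no_inv; exists z, x, y.
pose S := section z; pose T := {x : H | S x}.
pose le (x y : T) := nbh_le (val x) (val y).
pose dj (x y : T) := ~~ adj (val x) (val y).
(* The orientation anchored at [z], restricted to the section, is the consistent choice required by
   the interval construction. *)
have [] := @interval_realizer T le dj _ _ _ _ _ _
  (fun x y => lex_orient (advance z) (val x) (val y)).
- by move=> x; apply: nbh_le_refl.
- by move=> x y l; apply: val_inj; apply: (nbh_le_anti no_twins).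
- by move=> x y w; apply: nbh_le_trans.
- by move=> x y; rewrite /dj adj_sym.
- by move=> x y; apply: contra; apply: nbh_le_adj.
- by move=> x y w /nbh_leP l; apply: contra => /l.
- by move=> x y n n'; apply: anchored_orientN => //; rewrite /incomp n n'.
- move=> x y y' n1 n2 n3 n4 a c.
  by apply: section_forced (valP x) (valP y) (valP y') _ _ _ _;
    rewrite ?/incomp ?n1 ?n2 ?n3 ?n4 //; move: a; rewrite /dj negbK.
move=> l [r [lr leE djE]].
pose ext (f : T -> nat) (x : H) := oapp f 0 (insub x).
have extE f x (Sx : S x) : ext f x = f (Sub x Sx) by rewrite /ext insubT.
apply: (@circular_arc_of_intervals R H no_twins paired S (ext l) (ext r)).
- exact: section_cover.
- exact: section_ncover.
- by move=> x Sx; rewrite !extE.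
- by move=> x y Sx Sy; rewrite !extE -leE.
- by move=> x y Sx Sy; rewrite !extE -djE.
Qed.

(** * Circular completions *)

Section Embeddings.
Variables (G H : lgraph) (f : G -> H).
Hypothesis f_inj : injective f.
Hypothesis f_adj : forall u v, adj (f u) (f v) = adj u v.

Lemma nbh_le_reflect u v : nbh_le (f u) (f v) -> nbh_le u v.
Proof. by move=> /nbh_leP l; apply/nbh_leP=> w; have := l (f w); rewrite !f_adj. Qed.

Lemma spanning_reflect u v : spanning_pair (f u) (f v) -> spanning_pair u v.
Proof.
move=> /spanning_pairP[h1 h2]; apply/spanning_pairP; split=> x n; apply: nbh_le_reflect.
  by apply: h1; rewrite f_adj.
by apply: h2; rewrite f_adj.
Qed.

Lemma type_preservingI :
  (forall u v, nbh_le u v -> nbh_le (f u) (f v)) ->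
  (forall u v, adj u v -> spanning_pair u v -> spanning_pair (f u) (f v)) ->
  type_preserving_embedding f.
Proof.
move=> le_f span_f.
have leE u v : nbh_le (f u) (f v) = nbh_le u v.
  by apply/idP/idP; [apply: nbh_le_reflect|apply: le_f].
split=> // u v a; have incE : inclusion_edge (f u) (f v) = inclusion_edge u v.
  by rewrite !inclusion_edgeE !leE.
have spE : spanning_pair (f u) (f v) = spanning_pair u v.
  by apply/idP/idP; [apply: spanning_reflect|apply: span_f].
by rewrite /overlap1_edge /overlap2_edge /overlap_edge incE spE f_adj.
Qed.

End Embeddings.

(** Otherwise a non-neighbour [x] of [v] would lie below [u], hence below [v], and so be adjacent to
    [v]. *)
Lemma spanning_nle (G : lgraph) (u v : G) :
  ~~ universal v -> spanning_pair u v -> ~~ nbh_le u v.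
Proof.
move=> nuv /spanning_pairP[h _]; apply/negP=> l.
case/negP: nuv; rewrite /universal finset.eqEsubset finset.subsetT /=.
apply/fintype.subsetP=> x _; rewrite in_nbh; apply: contraT => n.
by have := nbh_le_adj (nbh_le_trans (h x n) l); rewrite adj_sym (negPf n).
Qed.

Section TypePreserving.
Variables (G H : lgraph) (f : G -> H).
Hypothesis no_universal : forall u : G, ~~ universal u.
Hypothesis no_twins : forall u v : G, u != v -> ~~ true_twins u v.
Hypothesis f_tp : type_preserving_embedding f.

Lemma tp_adj u v : adj (f u) (f v) = adj u v.
Proof. by case: f_tp. Qed.

(** The edge type gives the inclusion only up to direction; the wrong direction would reflect to [G]
    and make [u] and [v] twins. *)
Lemma tp_nbh_le u v : nbh_le (f u) (f v) = nbh_le u v.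
Proof.
apply/idP/idP; first exact: nbh_le_reflect tp_adj _ _.
move=> l; case: f_tp => _ _ /(_ u v (nbh_le_adj l))[+ _ _].
rewrite !inclusion_edgeE l => /orP[//|/(nbh_le_reflect tp_adj) l'].
by have -> : u = v; [apply: (nbh_le_anti no_twins); rewrite l|apply: nbh_le_refl].
Qed.

Lemma tp_spanning u v : adj u v -> spanning_pair (f u) (f v) = spanning_pair u v.
Proof.
move=> a; apply/idP/idP; first exact: spanning_reflect tp_adj _ _.
move=> s; case: f_tp => _ _ /(_ u v a)[_ _]; rewrite /overlap2_edge s andbT.
rewrite !overlap_edgeE a /= => /esym o; suff : incomp u v by rewrite o => /andP[].
by rewrite /incomp !spanning_nle // spanning_sym.
Qed.

End TypePreserving.

Section Induced.
Variables (H : lgraph) (P : pred H).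

Definition induced : lgraph :=
  @LGraph {x : H | P x} (fun x y => adj (val x) (val y))
    (fun x y => adj_sym (val x) (val y)) (fun x => adj_refl (val x)).

Lemma induced_circularly_paired :
  (forall x, P x -> exists2 y, P y & ~~ adj x y /\
     ((forall w, P w -> ~~ adj y w -> nbh_le w x) /\
      (forall w, P w -> ~~ adj x w -> nbh_le w y))) ->
  circularly_paired induced.
Proof.
move=> h u; have [y Py [n [h1 h2]]] := h (val u) (valP u).
have le_val (x w : induced) : nbh_le (val x) (val w) -> nbh_le x w.
  exact: (@nbh_le_reflect induced H val (fun _ _ => erefl)).
exists (Sub y Py : induced); apply/andP; split; last by [].
apply/spanning_pairP; split=> w nw; apply: le_val.
  by apply: h1; [exact: valP|exact: nw].
by apply: h2; [exact: valP|exact: nw].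
Qed.

End Induced.

(** * Consequences of minimality of the completion *)

Section Completion.
Variables (G H : lgraph).
Hypothesis no_universal : forall u : G, ~~ universal u.
Hypothesis no_twins : forall u v : G, u != v -> ~~ true_twins u v.
Hypothesis paired : circularly_paired H.
Variable f : G -> H.
Hypothesis f_tp : type_preserving_embedding f.
Hypothesis H_min : forall H' : lgraph, circular_extension G H' -> #|H| <= #|H'|.

Local Notation leE := (tp_nbh_le no_twins f_tp).

(** The subgraph induced on [P] is again a circular extension, since inclusions and spanning pairs
    pass to induced subgraphs. Minimality is exploited below by choosing [P]. *)
Lemma completion_full (P : pred H) : (forall u, P (f u)) ->
  circularly_paired (induced P) -> forall h, P h.
Proof.
move=> Pf pairedP; have : circular_extension G (induced P).
  split=> //; exists (fun u => Sub (f u) (Pf u)); apply: type_preservingI.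
  - by move=> u v e; have [f_inj _ _] := f_tp; apply: f_inj; have := congr1 val e.
  - exact: tp_adj f_tp.
  - by move=> u v; rewrite -leE => l; apply: (@nbh_le_reflect (induced P) H val).
  - move=> u v a; rewrite -(tp_spanning no_universal f_tp a) => s.
    by apply: (@spanning_reflect (induced P) H val).
move=> /H_min; rewrite [#|induced P|]card_sig => le h.
have := subset_leqif_cards (finset.subsetT [set x | P x]); rewrite cardsE cardsT.
case=> _ /esym; rewrite eqn_leq max_card le /= => /eqP; move/finset.setP/(_ h).
by rewrite !inE => ->.
Qed.

(** A twin outside the image could be deleted, its copy taking over as partner; two twins inside the
    image would already be twins in [G]. *)
Lemma completion_no_twins (u v : H) : u != v -> ~~ true_twins u v.
Proof.
have aux (x y : H) : x != y -> nbh_le x y -> nbh_le y x -> y \in codom f.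
  move=> xy lxy lyx; apply: contraT => ny.
  suff /(_ y) : forall h, predC1 y h by rewrite /= eqxx.
  apply: completion_full => [a|]; first by rewrite /=; apply: contraNneq ny => <-; apply: codom_f.
  apply: induced_circularly_paired => h /= nhy; have [k /andP[s n]] := paired h.
  suff [k' nk' [/spanning_pairP[s1 s2] n']] : exists2 k', k' != y & spanning_pair h k' /\ ~~ adj h k'.
    by exists k' => //; split=> //; split=> w _; [apply: s1|apply: s2].
  have [e|nky] := eqVneq k y; last by exists k.
  subst k; exists x => //; split; first exact: spanning_le s lyx.
  by rewrite adj_sym; apply: contra n => a; rewrite adj_sym; move/nbh_leP: lxy; apply.
move=> uv; apply/negP=> /eqP e.
have luv : nbh_le u v by rewrite /nbh_le e subxx.
have lvu : nbh_le v u by rewrite /nbh_le e subxx.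
have /codomP[b eb] := aux u v uv luv lvu.
have /codomP[a ea] : u \in codom f by apply: (aux v) => //; rewrite eq_sym.
subst u v; rewrite !leE in luv lvu.
by case/eqP: uv; congr f; apply: (nbh_le_anti no_twins); rewrite luv.
Qed.

Local Notation bar := (@copair H).
Let barK : involutive bar := copairK completion_no_twins paired.

Lemma completion_cover h : h \in codom f \/ bar h \in codom f.
Proof.
apply/orP; move: h; apply: (@completion_full (fun h => (h \in codom f) || (bar h \in codom f))).
  by move=> u; rewrite codom_f.
apply: induced_circularly_paired => h Ph; exists (bar h); first by rewrite barK orbC.
split; first exact: copair_nonadj.
have /andP[/spanning_pairP[s1 s2] _] := copairP paired h.
by split=> w _; [apply: s1|apply: s2].
Qed.

(** Otherwise the partners of [f u] and [f v] both lie outside the image and could be deleted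
    together, [f u] and [f v] becoming partners of each other. *)
Lemma completion_circular_pair u v : circular_pair u v -> f v = bar (f u).
Proof.
move=> uv; apply/eqP; apply: contraT => ne.
have vu : circular_pair v u by rewrite circular_pair_sym.
have twin (a b c : G) : circular_pair a b -> circular_pair a c -> b = c.
  move=> /andP[/spanning_pairP[b1 b2] nb] /andP[/spanning_pairP[c1 c2] nc].
  by apply: (nbh_le_anti no_twins); rewrite c2 // b2.
have bar_pair a b : f b = bar (f a) -> circular_pair a b.
  move=> e; have := copairP paired (f a); rewrite -e => /andP[s n].
  by rewrite /circular_pair (spanning_reflect (tp_adj f_tp) s) -(tp_adj f_tp).
have notbar a b w : circular_pair a b -> f b != bar (f a) -> f w != bar (f a).
  move=> ab nab; apply: contra nab => /eqP /[dup] e /bar_pair aw.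
  by rewrite (twin _ _ _ ab aw) e.
have ne' : f u != bar (f v).
  by apply: contra ne => /eqP->; rewrite barK.
pose P h := (h != bar (f u)) && (h != bar (f v)).
suff /(_ (bar (f u))) : forall h, P h by rewrite /P eqxx.
apply: completion_full => [w|].
  by rewrite /P (notbar u v w) // (notbar v u w).
have main a b : circular_pair a b -> forall h, P h -> f b != bar (f a) ->
    (h != bar (f b)) -> ~~ adj (f b) h -> nbh_le h (f a).
  move=> /andP[sab nab] h Ph nba hb n.
  have [/codomP[w e]|/codomP[w e]] := completion_cover h.
    subst h; rewrite leE; rewrite (tp_adj f_tp) in n.
    by case/spanning_pairP: sab => + _; apply.
  have eh : h = bar (f w) by rewrite -e barK.
  subst h; rewrite (copair_leC completion_no_twins paired).
  (* For [h = bar (f w)] this says that [b] is below [w], so [a] and [w] span. If they are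
     non-adjacent, uniqueness of circular partners in [G] gives [w = b], and [h] is a deleted
     vertex. *)
  rewrite (adjE paired) barK negbK leE in n.
  have saw := spanning_le sab n.
  have [a1|n1] := boolP (adj a w).
    rewrite -(spanningE completion_no_twins paired).
    by rewrite (tp_spanning no_universal f_tp a1).
  case/eqP: hb; congr (bar (f _)); apply: (twin a); last exact/andP.
  exact/andP.
have pr a b h : circular_pair a b -> f b != bar (f a) -> f a != bar (f b) ->
    (forall w, P w -> w != bar (f a) /\ w != bar (f b)) ->
    h = f a -> exists2 y, P y & ~~ adj h y /\
     ((forall w, P w -> ~~ adj y w -> nbh_le w h) /\
      (forall w, P w -> ~~ adj h w -> nbh_le w y)).
  move=> ab n1 n2 Pab ->; exists (f b).
    rewrite /P (notbar u v b) // (notbar v u b) //.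
  split; first by rewrite (tp_adj f_tp); case/andP: ab.
  have ba : circular_pair b a by rewrite circular_pair_sym.
  split=> w Pw; have [p1 p2] := Pab _ Pw; first exact: main.
  exact: main.
apply: induced_circularly_paired => h Ph.
have [e|nhu] := eqVneq h (f u).
  by apply: (pr u v) => // w /andP[].
have [e|nhv] := eqVneq h (f v).
  by apply: (pr v u) => // w /andP[].
exists (bar h).
  by rewrite /P !(inj_eq (inv_inj barK)) nhu nhv.
split; first exact: copair_nonadj.
have /andP[/spanning_pairP[s1 s2] _] := copairP paired h.
by split=> w _; [apply: s1|apply: s2].
Qed.

Lemma completion_spanning u v : spanning_pair (f u) (f v) = spanning_pair u v.
Proof.
have [a|n] := boolP (adj u v); first exact: tp_spanning.
apply/idP/idP; first exact: spanning_reflect (tp_adj f_tp) _ _.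
move=> s; rewrite (@completion_circular_pair u v); last exact/andP.
by case/andP: (copairP paired (f u)).
Qed.

End Completion.

(** * Existence of circular completions *)

Section Existence.
Variable G : lgraph.
Hypothesis no_universal : forall u : G, ~~ universal u.
Hypothesis no_twins : forall u v : G, u != v -> ~~ true_twins u v.

(* [inr u] plays the role of the complement of the arc [u]. *)
Definition double_adj (x y : G + G) : bool :=
  match x, y with
  | inl u, inl v => adj u v
  | inl u, inr v => ~~ nbh_le u v
  | inr u, inl v => ~~ nbh_le v u
  | inr u, inr v => ~~ spanning_pair u v
  end.

Lemma double_adj_sym : symmetric double_adj.
Proof. by move=> [u|u] [v|v] //=; rewrite ?[adj v u]adj_sym ?(spanning_sym v). Qed.

Lemma double_adj_refl : reflexive double_adj.
Proof.
move=> [u|u] /=; first exact: adj_refl.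
by apply/negP=> /(spanning_nle (no_universal u)); rewrite nbh_le_refl.
Qed.

Definition double : lgraph := LGraph double_adj_sym double_adj_refl.

Definition dl (u : G) : double := inl u.
Definition dr (u : G) : double := inr u.

Lemma double_le u v : nbh_le u v -> nbh_le (dl u) (dl v).
Proof.
move=> l; apply/nbh_leP=> -[w|w] /=; first by move/nbh_leP: l; apply.
by apply: contra => l'; apply: nbh_le_trans l l'.
Qed.

Lemma double_le_rr u v : nbh_le u v -> nbh_le (dr v) (dr u).
Proof.
move=> l; apply/nbh_leP=> -[w|w] /=; apply: contra => h.
  exact: nbh_le_trans h l.
by rewrite spanning_sym; apply: spanning_le l; rewrite spanning_sym.
Qed.

Lemma double_le_lr u v : ~~ adj u v -> nbh_le (dl u) (dr v).
Proof.
move=> n; apply/nbh_leP=> -[w|w] /=.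
  by apply: contraL => l; apply: contra n => a; rewrite adj_sym; move/nbh_leP: l; apply; rewrite adj_sym.
by apply: contra => /spanning_pairP[_]; apply; rewrite adj_sym.
Qed.

Lemma double_le_rl u v : spanning_pair u v -> nbh_le (dr u) (dl v).
Proof.
move=> s; apply/nbh_leP=> -[w|w] /=; apply: contraR.
  by case/spanning_pairP: s => h _; apply: h.
by rewrite negbK => l; apply: spanning_le s l.
Qed.

Lemma double_extension : circular_extension G double.
Proof.
split.
  have main u : circular_pair (dl u) (dr u).
    apply/andP; split; last by rewrite /= nbh_le_refl.
    apply/spanning_pairP; split=> -[w|w] /=; rewrite ?negbK.
    - exact: double_le.
    - by rewrite spanning_sym; apply: double_le_rl.
    - by rewrite adj_sym; apply: double_le_lr.
    - exact: double_le_rr.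
  by move=> [u|u]; [exists (dr u)|exists (dl u); rewrite circular_pair_sym]; apply: main.
exists dl; apply: type_preservingI => //.
- by move=> u v [].
- exact: double_le.
- move=> u v _ s; apply/spanning_pairP; split=> -[w|w] /=; rewrite ?negbK => h.
  + by apply: double_le; case/spanning_pairP: s => + _; apply.
  + by apply: double_le_rl; rewrite spanning_sym; apply: spanning_le h.
  + by apply: double_le; case/spanning_pairP: s => _; apply.
  + by apply: double_le_rl; rewrite spanning_sym; apply: spanning_le h; rewrite spanning_sym.
Qed.

Lemma circular_completion_exists : exists H : lgraph, circular_completion G H.
Proof.
suff : forall n (H : lgraph), #|H| <= n -> circular_extension G H ->
    exists H : lgraph, circular_completion G H.
  by move/(_ #|double| double (leqnn _)); apply; apply: double_extension.
elim=> [|n IH] H cH eH.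
  by exists H; split=> // H' _; apply: leq_trans cH _.
have [[H' [eH' lt]]|no] := boolp.EM (exists H', circular_extension G H' /\ #|H'| < #|H|).
  by apply: (IH H') => //; rewrite -ltnS; apply: leq_trans lt cH.
exists H; split=> // H' eH'; rewrite leqNgt; apply/negP=> lt.
by apply: no; exists H'.
Qed.

End Existence.

(** * Normalised circular-arc models *)

Section CircularArcModels.
Import Order.TTheory GRing.Theory Num.Theory.
Local Open Scope ring_scope.
Variable R : realType.
Implicit Types (a b c d : R) (n m : int).

Definition frac (x : R) : R := x - (Num.floor x)%:~R.

Lemma frac_itv (x : R) : 0 <= frac x < 1.
Proof.
have /andP[h1 h2] := floor_itv x; rewrite intrD in h2.
by rewrite /frac; apply/andP; split; lra.
Qed.

Lemma fracE (x : R) : exists n, frac x = x + n%:~R.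
Proof. by exists (- Num.floor x); rewrite intrN. Qed.

Lemma intr_ge0 n : -1 < n%:~R :> R -> 0 <= n%:~R :> R.
Proof. by rewrite -[-1]/((-1)%:~R) ltr_int ler0z; lia. Qed.

Lemma intr_ge1 n : 0 < n%:~R :> R -> 1 <= n%:~R :> R.
Proof. by rewrite ltr0z -[1]/(1%:~R) ler_int; lia. Qed.

(** The fractional part is the least non-negative representative modulo 1; it measures
    counterclockwise distance on the circle. *)
Lemma frac_le (x : R) n : 0 <= x + n%:~R -> frac x <= x + n%:~R.
Proof.
move=> h; have [m e] := fracE x; have := frac_itv x; rewrite e => /andP[h0 h1].
have := @intr_ge0 (n - m); rewrite intrB => k.
have : -1 < n%:~R - m%:~R :> R by lra.
by move=> /k; lra.
Qed.

(* Inclusion of the half-open arcs [[a, b)] and [[c, d)] of R/Z; the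
   complement of [[a, b)] is [[b, a + 1)]. *)
Definition arc_le a b c d : Prop :=
  exists n, c <= a + n%:~R /\ b + n%:~R <= d.

Lemma arc_le_trans a b c d a' b' :
  arc_le a b a' b' -> arc_le a' b' c d -> arc_le a b c d.
Proof.
by case=> n [h1 h2] [m [h3 h4]]; exists (n + m); rewrite intrD; split; lra.
Qed.

Lemma arc_le_compl a b c d : arc_le a b c d -> arc_le d (c + 1) b (a + 1).
Proof. by case=> n [h1 h2]; exists (- n); rewrite intrN; split; lra. Qed.

Lemma arc_le_shift a b c d : arc_le a b (c + 1) (d + 1) <-> arc_le a b c d.
Proof.
by split=> -[n [h1 h2]]; [exists (n - 1)|exists (n + 1)];
  rewrite ?intrB ?intrD; split; lra.
Qed.

Lemma arc_le_shiftl a b c d : arc_le (a + 1) (b + 1) c d <-> arc_le a b c d.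
Proof.
by split=> -[n [h1 h2]]; [exists (n + 1)|exists (n - 1)];
  rewrite ?intrB ?intrD; split; lra.
Qed.

Lemma arc_le_disjC a b c d : arc_le a b d (c + 1) -> arc_le c d b (a + 1).
Proof. by move/arc_le_compl/arc_le_shiftl. Qed.

Definition arc_model (G : lgraph) (a b : G -> R) : Prop :=
  [/\ forall u, a u < b u < a u + 1,
      forall u v, nbh_le u v <-> arc_le (a u) (b u) (a v) (b v) &
      forall u v, ~~ adj u v <-> arc_le (a u) (b u) (b v) (a v + 1)].

Lemma nearest_nonneighbour (G : lgraph) (no_universal : forall u : G, ~~ universal u)
    (d : G -> G -> R) :
  exists s : G -> G, forall u, ~~ adj u (s u) /\
    forall w, ~~ adj u w -> d u (s u) <= d u w.
Proof.
apply: (fin_all_exists (P := fun u s => ~~ adj u s /\ forall w, ~~ adj u w -> d u s <= d u w)) => u.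
have [w0 nw0] : exists w, ~~ adj u w.
  apply/existsP; apply: contraR (no_universal u) => /existsPn h.
  rewrite /universal finset.eqEsubset finset.subsetT /=.
  by apply/fintype.subsetP=> w _; rewrite in_nbh; have := h w; rewrite negbK.
by case: (@arg_minP _ R _ w0 (fun w => ~~ adj u w) (d u) nw0) => s ns smin; exists s.
Qed.

Section Normalisation.
Variable G : lgraph.
Hypothesis no_universal : forall u : G, ~~ universal u.
Variables l r : G -> R.
Hypothesis lr : forall u, l u <= r u.
Hypothesis adj_arcs : forall u v,
  adj u v <-> (Defs.arc (l u) (r u) `&` Defs.arc (l v) (r v) !=set0)%classic.

Let nadjC (u v : G) : ~~ adj u v -> ~~ adj v u.
Proof. by rewrite adj_sym. Qed.

Lemma nonadj_gap u v : ~~ adj u v -> r u - l u < frac (l v - l u).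
Proof.
move=> n; rewrite ltNge; apply: contra n => h.
apply/adj_arcs/arc_meetP => //; have [k e] := fracE (l v - l u).
have := frac_itv (l v - l u); have := lr v; rewrite e in h * => ? ?.
by exists k; split; lra.
Qed.

Lemma adj_gap u v : adj u v ->
  frac (l v - l u) <= r u - l u \/ frac (l u - l v) <= r v - l v.
Proof.
move=> /adj_arcs/arc_meetP; case=> // k [h1 h2].
have [h|h] := leP (l u) (l v + k%:~R).
  by left; apply: (le_trans (@frac_le _ k _)); lra.
by right; apply: (le_trans (@frac_le _ (- k) _)); rewrite intrN; lra.
Qed.

(* First every arc is extended at its right end up to the next left end of a
   non-neighbour, then at its left end down to the previous (new) right end of
   a non-neighbour; doing both at once could make non-neighbours meet. *)
Lemma arc_normalisation : exists a b : G -> R,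
  arc_model a b /\
  forall u v, spanning_pair u v <-> arc_le (b u) (a u + 1) (a v) (b v).
Proof.
(* [s u] is the non-neighbour whose left end follows that of [u] soonest; [w u] is the length after
   the first extension. *)
have [s s_min] := nearest_nonneighbour no_universal (fun u v => frac (l v - l u)).
have ns u : ~~ adj u (s u) by case: (s_min u).
pose w u := frac (l (s u) - l u); pose b u := l u + w u.
have w_min u v : ~~ adj u v -> w u <= frac (l v - l u) by case: (s_min u) => _; apply.
have w_lt1 u : w u < 1 by case/andP: (frac_itv (l (s u) - l u)).
have w_gap u : r u - l u < w u by apply: nonadj_gap.
have w_gt0 u : 0 < w u by have := w_gap u; have := lr u; lra.
have bE u : exists n, b u = l (s u) + n%:~R.
  have [n e] := fracE (l (s u) - l u); exists n; rewrite /b /w e; lra.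
have w_adj u v : adj u v -> frac (l v - l u) < w u \/ frac (l u - l v) < w v.
  by move=> /adj_gap[h|h]; [left|right]; apply: le_lt_trans h _.
(* [p u] is the non-neighbour whose new right end precedes [b u] most closely; [t u] is the final
   length. *)
have [p p_min] := nearest_nonneighbour no_universal (fun u v => frac (b u - b v)).
have np u : ~~ adj u (p u) by case: (p_min u).
pose t u := frac (b u - b (p u)); pose a u := b u - t u.
have t_min u v : ~~ adj u v -> t u <= frac (b u - b v) by case: (p_min u) => _; apply.
have t_lt1 u : t u < 1 by case/andP: (frac_itv (b u - b (p u))).
have w_le u v : ~~ adj u v -> w u <= frac (b u - b v).
  move=> n; rewrite leNgt; apply/negP; have [k e] := fracE (b u - b v).
  have := frac_itv (b u - b v); rewrite e => /andP[h0 h1] h.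
  have := w_min _ _ n; have := w_min _ _ (nadjC n); have := w_gt0 v.
  rewrite /b in h0 h1 h; move=> w0.
  have [c|c] := leP 0 (l v - l u - k%:~R).
    by have := @frac_le (l v - l u) (- k); rewrite intrN => /(_ c); lra.
  by have := @frac_le (l u - l v) k; move=> H h2 h3; have := H; lra.
have a_le u : a u <= l u.
  have := w_le _ _ (np u); rewrite -/(t u) /a /b; lra.
have l_lt u : l u < b u by have := w_gt0 u; rewrite /b; lra.
have aE u : exists n, a u = b (p u) + n%:~R.
  have [n e] := fracE (b u - b (p u)); exists (- n); rewrite /a /t e intrN; lra.
have disj u v : ~~ adj u v -> arc_le (a u) (b u) (b v) (a v + 1).
  move=> n; have h1 := t_min _ _ n; have h2 := t_min _ _ (nadjC n).
  have h3 := w_le _ _ n; have h4 := w_le _ _ (nadjC n).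
  have := frac_itv (b u - b v); have := frac_itv (b v - b u).
  have [k e] := fracE (b u - b v); have [k' e'] := fracE (b v - b u).
  rewrite e e' in h1 h2 h3 h4 * => /andP[h5 h6] /andP[h7 h8].
  have := w_gt0 u; have := w_gt0 v => w1 w2.
  (* The two fractional parts are positive, less than 1 and sum to the integer [k + k'], which is
     therefore 1. *)
  have := @intr_ge1 (k + k'); rewrite intrD => /(_ ltac:(lra)) k1.
  have := @intr_ge0 (1 - (k + k')); rewrite intrB intrD => /(_ ltac:(lra)) k2.
  by exists k; rewrite /a; split; lra.
have ndisj u v : arc_le (a u) (b u) (b v) (a v + 1) -> ~~ adj u v.
  have aux u' v' : frac (l v' - l u') < w u' -> ~ arc_le (a u') (b u') (b v') (a v' + 1).
    have [j e] := fracE (l v' - l u'); have := frac_itv (l v' - l u').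
    rewrite e => /andP[j0 j1] j2 [n [h1 h2]].
    have := a_le u'; have := a_le v'; have := l_lt v' => h3 h4 h5.
    have := @intr_ge1 (j + n); rewrite intrD => /(_ ltac:(lra)) k1.
    by move: h2 j2; rewrite /b; lra.
  move=> h; apply/negP=> /w_adj[]; first by move/aux; apply.
  by move/aux; apply; apply: arc_le_disjC.
have leI u v : arc_le (a u) (b u) (a v) (b v) -> nbh_le u v.
  move=> h; apply/nbh_leP=> x; apply: contraLR => /disj h'; apply: ndisj.
  exact: arc_le_trans h h'.
have meet u v : adj u v -> exists k : int, a u < b v + k%:~R /\ a v + k%:~R < b u.
  have := a_le u; have := a_le v; have := l_lt u; have := l_lt v => h1 h2 h3 h4.
  move=> /w_adj[].
    have [j e] := fracE (l v - l u); have := frac_itv (l v - l u).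
    by rewrite e /b => /andP[j0 j1] j2; exists j; rewrite /b in h1 h2 *; split; lra.
  have [j e] := fracE (l u - l v); have := frac_itv (l u - l v).
  by rewrite e /b => /andP[j0 j1] j2; exists (- j); rewrite intrN /b in h1 h2 *; split; lra.
have leE u v : nbh_le u v -> arc_le (a u) (b u) (a v) (b v).
  move=> lev.
  have nadj_up x : ~~ adj v x -> ~~ adj u x by apply: contra; move/nbh_leP: lev; apply.
  have [k [k1 k2]] := meet u v (nbh_le_adj lev).
  (* On the circle [b v] is the old left end of the non-neighbour [s v] of [v]. An arc of [u]
     running past it would meet [s v], which is not adjacent to [u] either. The left end is treated
     likewise with [p v]. *)
  have h1 : b u <= b v + k%:~R.
    rewrite leNgt; apply/negP=> k3.
    have [n [n1 n2]] := disj _ _ (nadj_up _ (ns v)); have [j e] := bE v.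
    have := l_lt (s v); have := a_le (s v); rewrite e in k1 k3 * => h1 h2.
    have := @intr_ge1 (j + k + n); rewrite !intrD => /(_ ltac:(lra)) ?; lra.
  have h2 : a v + k%:~R <= a u.
    rewrite leNgt; apply/negP=> k3.
    have [n [n1 n2]] := disj _ _ (nadj_up _ (np v)); have [j e] := aE v.
    have := l_lt (p v); have := a_le (p v); rewrite e in k2 k3 * => h2 h3.
    have := @intr_ge1 (j + k + n); rewrite !intrD => /(_ ltac:(lra)) ?; lra.
  by exists (- k); rewrite intrN; split; lra.
exists a, b; split; first split.
- move=> u; have := a_le u; have := l_lt u; have := t_lt1 u; rewrite /a => ? ? ?.
  by apply/andP; split; lra.
- by move=> u v; split; [apply: leE|apply: leI].
- by move=> u v; split; [apply: disj|apply: ndisj].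
move=> u v; split; last first.
  move=> h; apply/spanning_pairP; split=> x n; apply: leI.
    have h' := arc_le_compl h; apply: arc_le_trans (disj _ _ (nadjC n)) _.
    by apply/arc_le_shift.
  exact: arc_le_trans (disj _ _ (nadjC n)) h.
move=> sp; have /spanning_pairP[sp1 _] := sp.
(* Both [s v] and [p v] lie inside [u], so both ends of [v] fall on the arc of [u]: either [v] is
   inside [u], which is excluded, or the two arcs cover the circle. *)
have [k [k1 k2]] : exists k : int, a u <= b v + k%:~R /\ b v + k%:~R < b u.
  have [n [n1 n2]] := leE _ _ (sp1 _ (ns v)); have [j e] := bE v.
  have := l_lt (s v); have := a_le (s v) => h1 h2.
  by exists (n - j); rewrite e intrB; split; lra.
have [k' [k3 k4]] : exists k : int, a u < a v + k%:~R /\ a v + k%:~R <= b u.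
  have [n [n1 n2]] := leE _ _ (sp1 _ (np v)); have [j e] := aE v.
  have := l_lt (p v); have := a_le (p v) => h1 h2.
  by exists (n - j); rewrite e intrB; split; lra.
have [c|c] := ltP (a u) (a v + k%:~R).
  have : nbh_le v u by apply: leI; exists k; split; lra.
  by rewrite (negPf (spanning_nle (no_universal u) _)) // spanning_sym.
have := @intr_ge1 (k' - k); rewrite intrB => /(_ ltac:(lra)) k5.
by exists (- k - 1); rewrite intrB intrN; split; lra.
Qed.

End Normalisation.

(** * The order of left ends after cutting the circle at the anchor *)

Section AnchoredLifts.
Variables (H : lgraph) (a b : H -> R).
Hypothesis ab_model : arc_model a b.
Variable z : H.

Let ab u : a u < b u < a u + 1. Proof. by case: ab_model. Qed.
Let leE u v : nbh_le u v <-> arc_le (a u) (b u) (a v) (b v).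
Proof. by case: ab_model. Qed.
Let nadjE u v : ~~ adj u v <-> arc_le (a u) (b u) (b v) (a v + 1).
Proof. by case: ab_model. Qed.

Definition lift_l (u : H) : R := a z + frac (a u - a z).
Definition lift_r (u : H) : R := lift_l u + (b u - a u).

Lemma lift_shift u : exists n, lift_l u = a u + n%:~R /\ lift_r u = b u + n%:~R.
Proof.
have [n e] := fracE (a u - a z); exists n.
by rewrite /lift_r /lift_l e; split; lra.
Qed.

Lemma lift_bounds u : incomp z u ->
  [/\ a z < lift_l u, lift_l u < a z + 1, b z < lift_r u & lift_r u < b z + 1].
Proof.
move=> /andP[nzu nuz]; have [n [e1 e2]] := lift_shift u.
have := frac_itv (a u - a z) => /andP[f0 f1].
have l0 : a z <= lift_l u by rewrite /lift_l; lra.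
have l1 : lift_l u < a z + 1 by rewrite /lift_l; lra.
have r0 : b z < lift_r u.
  rewrite ltNge; apply: contra nuz => h; apply/leE; exists n; split; lra.
have r1 : lift_r u < b z + 1.
  rewrite ltNge; apply: contra nzu => h; apply/leE; exists (1 - n).
  by rewrite intrB; split; lra.
split=> //; rewrite lt_neqAle l0 andbT; apply: contra nzu => /eqP e.
by apply/leE; exists (- n); rewrite intrN; split; lra.
Qed.

Lemma lift_le u v : incomp z u -> incomp z v ->
  nbh_le u v = (lift_l v <= lift_l u) && (lift_r u <= lift_r v).
Proof.
move=> /lift_bounds[u1 u2 u3 u4] /lift_bounds[v1 v2 v3 v4].
have [n [e1 e2]] := lift_shift u; have [m [e3 e4]] := lift_shift v.
apply/idP/andP => [/leE[k [k1 k2]]|[h1 h2]].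
  have := @intr_ge0 (k + m - n); rewrite intrB intrD => /(_ ltac:(lra)) k3.
  have := @intr_ge0 (n - (k + m)); rewrite intrB intrD => /(_ ltac:(lra)) k4.
  by split; lra.
by apply/leE; exists (n - m); rewrite intrB; split; lra.
Qed.

Lemma lift_meet_adj u v : lift_l u < lift_l v -> lift_l v < lift_r u -> adj u v.
Proof.
move=> h1 h2; apply: contraT => /nadjE[k [k1 k2]].
have [n [e1 e2]] := lift_shift u; have [m [e3 e4]] := lift_shift v.
have /andP[abv _] := ab v.
have := @intr_ge1 (k + m - n); rewrite intrB intrD => /(_ ltac:(lra)) k3; lra.
Qed.

(* Two arcs that both cross [z] may meet inside [z] only, where their lifts need
   not meet. *)
Lemma adj_lift_meet u v : incomp z u -> incomp z v ->
  ~~ adj z u || ~~ adj z v -> lift_l u < lift_l v -> adj u v -> lift_l v < lift_r u.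
Proof.
move=> /lift_bounds[u1 u2 u3 u4] /lift_bounds[v1 v2 v3 v4] nz luv.
have [n [e1 e2]] := lift_shift u; have [m [e3 e4]] := lift_shift v.
have /andP[abz1 abz2] := ab z.
have inside x : [/\ a z < lift_l x, lift_l x < a z + 1, b z < lift_r x & lift_r x < b z + 1] ->
    ~~ adj z x -> b z <= lift_l x /\ lift_r x <= a z + 1.
  move=> [x1 x2 x3 x4]; rewrite adj_sym => /nadjE[k [k1 k2]].
  have [i [e5 e6]] := lift_shift x.
  have := @intr_ge0 (k - i); rewrite intrB => /(_ ltac:(lra)) k3.
  have := @intr_ge0 (i - k); rewrite intrB => /(_ ltac:(lra)) k4.
  by split; lra.
apply: contraLR; rewrite -leNgt => h; apply/nadjE.
apply: arc_le_disjC; exists (m - n); rewrite intrB; split; first lra.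
have : lift_r v <= lift_l u + 1; last lra.
by case/orP: nz => /inside[] //; lra.
Qed.

Lemma lift_incomp u v : incomp z u -> incomp z v -> incomp u v ->
  lift_l u < lift_l v /\ lift_r u < lift_r v \/ lift_l v < lift_l u /\ lift_r v < lift_r u.
Proof.
move=> zu zv; rewrite /incomp !lift_le // !negb_and -!ltNge.
move=> /andP[/orP[h1|h1] /orP[h2|h2]]; auto.
- by have := lt_trans h1 h2; rewrite ltxx.
- by have := lt_trans h1 h2; rewrite ltxx.
Qed.

(** If [y] and [y'] lay on different sides of [x], they would overlap each other. Avoiding [z] then
    keeps one of them off [z], so their lifts meet, around [x]; thus [x] overlaps both, which the
    move forbids. *)
Lemma lift_advance1 x y y' : advance1 z x y y' -> lift_l x < lift_l y -> lift_l x < lift_l y'.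
Proof.
rewrite advance1E => /and5P[zx zy zy' xy /and4P[xy' a_yy' cz cx]] lxy.
case: (lift_incomp zx zy xy) => [[_ rxy]|[l2 _]]; last by rewrite ltNge (ltW l2) in lxy.
case: (lift_incomp zx zy' xy') => [[//]|[l2 r2]].
have i : incomp y y'.
  by rewrite /incomp !lift_le // !negb_and -!ltNge; apply/andP; split;
    apply/orP; [right|left]; apply: lt_trans; eassumption.
have ov_yy' : overlap_edge y y' by rewrite overlap_edgeE a_yy'.
move: cz cx; rewrite ov_yy' !implybF !overlap_edgeE zy zy' xy xy' !andbT !negb_and => cz cx.
have m : lift_l y < lift_r y'.
  apply: (adj_lift_meet (u := y') (v := y)) => //; last by rewrite adj_sym.
    by rewrite orbC.
  exact: lt_trans l2 lxy.
have axy' : adj x y'.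
  rewrite adj_sym; apply: lift_meet_adj => //; exact: lt_trans lxy m.
have axy : adj x y.
  apply: lift_meet_adj => //; exact: lt_trans m r2.
by rewrite axy axy' in cx.
Qed.

Lemma lift_advance1_eq x y y' : advance1 z x y y' ->
  (lift_l x < lift_l y) = (lift_l x < lift_l y').
Proof.
move=> h; apply/idP/idP; apply: lift_advance1 => //.
by move: h; rewrite /advance1 adj_sym !(avoids_edge_sym _ y').
Qed.

Lemma lift_advance x y x' y' : advance z (x, y) (x', y') ->
  (lift_l x < lift_l y) = (lift_l x' < lift_l y').
Proof.
rewrite /advance /=; case/orP=> /andP[/eqP <-]; first exact: lift_advance1_eq.
move=> h; have e := lift_advance1_eq h; move: h.
rewrite advance1E => /and5P[zx zy zy' xy /and4P[xy' _ _ _]].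
have flip u : incomp z u -> incomp y u -> (lift_l u < lift_l y) = ~~ (lift_l y < lift_l u).
  move=> zu yu; rewrite -leNgt le_eqVlt; case: eqP => //= e'.
  by case: (lift_incomp zx zu yu) => -[]; rewrite e' ltxx.
by rewrite !flip // e.
Qed.

Lemma no_invertible_pair x y : ~ invertible_pair z x y.
Proof.
case=> -[xy _ _] [P [Q [wP wQ [sPQ av] zP zQ]]].
case: P wP sPQ av zP => // x1 P; case: Q wQ zQ => // y1 Q.
move=> /and3P[/eqP ey pQ /eqP lQ] zQ /and3P[/eqP ex pP /eqP lP] /= [sPQ] av zP; subst x1 y1.
have zavP s : avoids z s -> forall i, (i.+1 < size s)%N ->
    avoids_edge z (nth z s i) (nth z s i.+1).
  case/andP=> /(all_nthP z) h1 /(sortedP z) h2 i lti.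
  by rewrite /avoids_edge /avoids /= h1 ?(ltnW lti) // h1 // h2.
have pathE s u i : path (@adj H) u s -> (i < size s)%N -> adj (nth z (u :: s) i) (nth z s i).
  by move/(pathP z); apply.
(* One simultaneous step splits into two moves: first [Q] advances while [P] rests, then [P]
   advances while [Q] rests at its new vertex. This matches the asymmetric indices in
   [walks_avoid]. *)
have step i : (i < size P)%N ->
    advance1 z (nth z (x :: P) i) (nth z (y :: Q) i) (nth z Q i) /\
    advance1 z (nth z Q i) (nth z (x :: P) i) (nth z P i).
  move=> lti; have ltiQ : (i < size Q)%N by rewrite -sPQ.
  have [a1 a2] := av z i lti.
  have zp := zavP _ zP i lti; have zq := zavP _ zQ i ltiQ.
  rewrite /= in a1 a2 zp zq; rewrite /advance1 a1 a2 zp zq !avoids_edge_id !pathE //=.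
  by move: zp zq; rewrite !avoids_edgeE => /and3P[-> _ _] /and3P[_ -> _].
have inv i : (i <= size P)%N ->
    (lift_l x < lift_l y) = (lift_l (nth z (x :: P) i) < lift_l (nth z (y :: Q) i)).
  elim: i => [//|i IH] lti; rewrite IH 1?ltnW //.
  have [s1 s2] := step i lti.
  rewrite (@lift_advance _ _ (nth z (x :: P) i) (nth z Q i)); last by rewrite /advance /= eqxx s1.
  by apply: lift_advance; rewrite /advance /= eqxx s2 orbT.
have := inv _ (leqnn _); rewrite nth_last /= lP sPQ nth_last /= lQ => e.
have [P0|P0] := posnP (size P); first by rewrite (size0nil P0) /= in lP; rewrite lP eqxx in xy.
have [+ _] := step 0%N P0; rewrite advance1E /= => /and5P[zx zy _ ixy _].
by case: (lift_incomp zx zy ixy) => -[h _]; rewrite h in e;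
  [have h' : lift_l y < lift_l x by rewrite -e|have h' : lift_l x < lift_l y by rewrite e];
  have := lt_trans h h'; rewrite ltxx.
Qed.

End AnchoredLifts.

(** * Arc models of the completion *)

Section FromModel.
Variables (G H : lgraph).
Hypothesis no_universal : forall u : G, ~~ universal u.
Hypothesis no_twins : forall u v : G, u != v -> ~~ true_twins u v.
Hypothesis paired : circularly_paired H.
Variable f : G -> H.
Hypothesis f_tp : type_preserving_embedding f.
Hypothesis H_min : forall H' : lgraph, circular_extension G H' -> (#|H| <= #|H'|)%N.

Lemma completion_arc_model : circular_arc_graph R G ->
  exists a b : H -> R, arc_model a b.
Proof.
case=> l [r [lr adj_arcs]].
have [a [b [[ab leE nadjE] spE]]] := arc_normalisation no_universal lr adj_arcs.
have H_twins := completion_no_twins no_universal no_twins paired f_tp H_min.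
have barK := copairK H_twins paired.
(* A vertex of the image keeps its arc and a partner of one gets the complementary arc; by
   [completion_cover] there are no others. *)
pose Q h (e : R * R) := exists u, h = f u /\ e = (a u, b u) \/
  h = copair (f u) /\ e = (b u, a u + 1).
have [e eQ] : exists e : H -> R * R, forall h, Q h (e h).
  apply: fin_all_exists => h.
  have [/codomP[u hu]|/codomP[u hu]] := completion_cover no_universal no_twins paired f_tp H_min h.
    by exists (a u, b u), u; left.
  by exists (b u, a u + 1), u; right; rewrite -hu barK.
exists (fun h => (e h).1), (fun h => (e h).2); split.
- move=> h; have [u [[_ ->]|[_ ->]]] /= := eQ h; first exact: ab.
  by have /andP[h1 h2] := ab u; apply/andP; split; lra.
- move=> h k; have [u [[-> ->]|[-> ->]]] /= := eQ h; have [v [[-> ->]|[-> ->]]] /= := eQ k.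
  + by rewrite (tp_nbh_le no_twins f_tp).
  + by rewrite -[nbh_le _ _]negbK -(adjE paired) (tp_adj f_tp).
  + by rewrite -(spanningE H_twins paired) (completion_spanning no_universal no_twins paired f_tp H_min).
  + rewrite (le_copair2 H_twins paired) (tp_nbh_le no_twins f_tp) leE.
    by split=> [/arc_le_compl|/arc_le_compl/arc_le_shift/arc_le_shiftl].
- move=> h k; have [u [[-> ->]|[-> ->]]] /= := eQ h; have [v [[-> ->]|[-> ->]]] /= := eQ k.
  + by rewrite (tp_adj f_tp).
  + rewrite (adjE paired) barK negbK (tp_nbh_le no_twins f_tp) leE.
    by rewrite arc_le_shift.
  + rewrite (adjE paired) negbK (le_copair2 H_twins paired) (tp_nbh_le no_twins f_tp) leE.
    by split=> [/arc_le_compl|/arc_le_compl/arc_le_shift/arc_le_shiftl].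
  + rewrite (adjE paired) negbK barK -(spanningE H_twins paired).
    rewrite (completion_spanning no_universal no_twins paired f_tp H_min) spE.
    by rewrite arc_le_shift.
Qed.

End FromModel.
End CircularArcModels.

Theorem theorem1 (R : realType) (G : lgraph)
    (no_universal : forall u : G, ~~ universal u)
    (no_true_twins : forall u v : G, u != v -> ~~ true_twins u v) :
  (exists H : lgraph, circular_completion G H) /\
  (forall H : lgraph, circular_completion G H ->
     (circular_arc_graph R G <-> ~ has_anchored_invertible_pair H)).
Proof.
split; first exact: circular_completion_exists.
move=> H [[paired [f f_tp]] H_min]; split.
  move=> /(completion_arc_model no_universal no_true_twins paired f_tp H_min)[a [b ab]].
  by case=> z [x [y]]; apply: no_invertible_pair ab _ _ _.
have H_twins := completion_no_twins no_universal no_true_twins paired f_tp H_min.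
move=> /(circular_arc_of_no_invertible R H_twins paired)[l [r [lr adj_arcs]]].
exists (l \o f), (r \o f); split=> [u|u v] /=; first exact: lr.
by rewrite -(tp_adj f_tp).
Qed.
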